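(* Let $F$ be a field and let $r\ge9$ be an integer. Then there is a uniform layered graph $\Gamma=(V,E)$ with $V=\coprod_{i=0}^3V_i$, $V_0=\{*\}$ and $|V_3|=1$ such that $A(\Gamma)$ is a Koszul algebra with Hilbert series $$h(A(\Gamma),\tau)=(1-r\tau+r\tau^2-\tau^3)^{-1}.$$
   Context: Layered graphs: $\Gamma=(V,E)$ is a directed graph; for $e\in E$, $t(e)$ is its tail and $h(e)$ its head (the edge goes from $t(e)$ to $h(e)$). $\Gamma$ is layered if $V=\coprod_{i=0}^N V_i$ and, writing $|v|=i$ (the level of $v$) for $v\in V_i$, one has $|t(e)|=|h(e)|+1$ for every $e\in E$. $V$ is regarded as a poset: $u>v$ iff there is a directed path (with at least one edge) from $u$ to $v$. Uniform: vertices $v,v'$ of the same level $i>0$ are connected by a down-up sequence if there are $v=v_0,v_1,\dots,v_k=v'$ in $V_i$ and $w_1,\dots,w_k\in V_{i-1}$ with $w_j<v_{j-1}$ and $w_j<v_j$ for $j=1,\dots,k$ (a vertex is connected to itself by the sequence with $k=0$). $\Gamma$ is uniform if for any two edges $e,e'$ with $t(e)=t(e')$, the heads $h(e),h(e')$ are connected by a down-up sequence $v_0,\dots,v_k$ with $v_j<t(e)$ for all $j$. Standing assumption: the layered graphs considered are finite and have exactly one minimal vertex, so here $*$ is the only minimal vertex. The algebra $A(\Gamma)$: the associative unital $F$-algebra generated by the edges $e\in E$, subject to the following relations: for any two directed paths $(e_1,\dots,e_k)$ and $(f_1,\dots,f_k)$ (with $h(e_j)=t(e_{j+1})$, $h(f_j)=t(f_{j+1})$)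 having the same tail $t(e_1)=t(f_1)$ and the same head $h(e_k)=h(f_k)$, all coefficients in the central variable $t$ of $(t-e_1)\cdots(t-e_k)=(t-f_1)\cdots(t-f_k)$ agree. It is graded with each edge in degree 1, and $h(A,\tau)=\sum_n\dim(A_n)\tau^n$. Koszul is the standard notion for quadratic graded algebras. *)

(* Defs.v *)
From HB Require Import structures.
From mathcomp Require Import all_boot all_order all_algebra.
From mathcomp Require Import boolp.
From mathcomp Require Import monalg.

Set Implicit Arguments.
Unset Strict Implicit.
Unset Printing Implicit Defensive.

Import GRing.Theory.

Local Open Scope ring_scope.
Local Open Scope quotient_scope.

(** * Layered graphs *)

(* Vertices and edges are abstract finite types, so that parallel edges are
   allowed; [level] gives the decomposition of the vertices into the layers
   V_0, ..., V_N. *)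
Record layered_graph (N : nat) := LayeredGraph {
  vertex : finType;
  edge : finType;
  etail : edge -> vertex;
  ehead : edge -> vertex;
  level : vertex -> 'I_N.+1;
  level_edge : forall e : edge, level (etail e) = (level (ehead e)).+1 :> nat
}.

Section LayeredGraph.
Variables (N : nat) (G : layered_graph N).
Implicit Types (u v w : vertex G) (e : edge G) (s : seq (edge G)).

Definition layer (i : nat) : {set vertex G} := [set v | level v == i :> nat].

Definition adj u v : bool := [exists e, (etail e == u) && (ehead e == v)].

(* [below v u] is v < u: there is a directed path with at least one edge from
   u to v. *)
Definition below v u : bool :=
  [exists e, (etail e == u) && connect adj (ehead e) v].

Definition minimal v : bool := [forall w, ~~ below w v].

Definition down_up_step v v' : bool :=
  (level v == level v') &&
  [exists w, [&& (level w).+1 == level v :> nat, below w v & below w v']].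

(* v and v' are joined by a down-up sequence v = v_0, v_1, ..., v_k = v' all
   of whose terms v_j satisfy P; [s] lists v_1, ..., v_k. *)
Definition down_up_connected (P : pred (vertex G)) v v' : Prop :=
  exists s : seq (vertex G),
    [/\ path down_up_step v s, last v s = v' & all P (v :: s)].

Definition uniform : Prop :=
  forall e e' : edge G, etail e = etail e' ->
    down_up_connected (fun v => below v (etail e)) (ehead e) (ehead e').

(* [e :: s] is a directed path; it starts at [etail e] and ends at
   [ehead (last e s)]. *)
Definition is_dipath e s : bool := path (fun a b => ehead a == etail b) e s.

End LayeredGraph.

(** * The algebra of a layered graph *)

(* The free associative unital F-algebra on the edges of G, realised as the
   monoid algebra of the free monoid of words in the edges. *)
Notation free_alg F G := {malg F[{fmonom (edge G)}]}.

Section GraphAlgebra.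
Variables (F : fieldType) (N : nat) (G : layered_graph N).
Implicit Types (x y a b : free_alg F G).

Definition gen (e : edge G) : free_alg F G := << FMonom [:: e] >>.

(* (t - e_1) ... (t - e_k); the polynomial variable 'X is central. *)
Definition path_poly (s : seq (edge G)) : {poly (free_alg F G)} :=
  \prod_(e <- s) ('X - (gen e)%:P).

Definition relator x : Prop :=
  exists (e : edge G) (s : seq (edge G)) (f : edge G) (s' : seq (edge G)),
    [/\ is_dipath e s, is_dipath f s', size s = size s', etail e = etail f &
        ehead (last e s) = ehead (last f s')]
    /\ exists i : nat, x = (path_poly (e :: s) - path_poly (f :: s'))`_i.

(* The two-sided ideal generated by the relators: the finite sums of terms
   a * x * b with x a relator. *)
Inductive in_ideal : free_alg F G -> Prop :=
| in_ideal0 : in_ideal 0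
| in_idealD a x b y : relator x -> in_ideal y -> in_ideal (a * x * b + y).

Lemma in_ideal_add x y : in_ideal x -> in_ideal y -> in_ideal (x + y).
Proof.
by elim=> [|a r b z rr _ IH] Iy; rewrite ?add0r // -addrA; constructor; auto.
Qed.

Lemma in_idealMl c x : in_ideal x -> in_ideal (c * x).
Proof.
elim=> [|a r b z rr _ IH]; first by rewrite mulr0; constructor.
by rewrite mulrDr !mulrA; constructor.
Qed.

Lemma in_idealMr c x : in_ideal x -> in_ideal (x * c).
Proof.
elim=> [|a r b z rr _ IH]; first by rewrite mul0r; constructor.
by rewrite mulrDl -(mulrA (a * r)); constructor.
Qed.

Lemma mcoeff1_relator x : relator x -> mcoeff (@mone {fmonom (edge G)}) x = 0.
Proof.
move=> [e [s [f [s' [[_ _ szs _ _] [i ->]]]]]].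
have cpath s0 : map_poly (mcoeff (@mone {fmonom (edge G)})) (path_poly s0) = 'X^(size s0).
  rewrite rmorph_prod /= (eq_bigr (fun=> 'X)) ?big_const_seq ?count_predT.
    by rewrite -Monoid.iteropE.
  move=> e0 _; rewrite rmorphB /= map_polyX map_polyC /= mcoeffU1.
  by rewrite -val_eqE /= fm1 polyC0 subr0.
by rewrite -coef_map rmorphB /= !cpath /= szs subrr coef0.
Qed.

Lemma in_ideal_proper : ~ in_ideal 1.
Proof.
have cI x : in_ideal x -> mcoeff (@mone {fmonom (edge G)}) x = 0.
  elim=> [|a r b z rr _ IH]; first exact: rmorph0.
  rewrite rmorphD !rmorphM /=; apply/eqP.
  by rewrite [X in _ * X * _]mcoeff1_relator // mulr0 mul0r add0r IH.
by move/cI/eqP; rewrite rmorph1 oner_eq0.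
Qed.

Definition ideal : {pred free_alg F G} := fun x => `[< in_ideal x >].

Lemma idealP x : reflect (in_ideal x) (x \in ideal).
Proof. exact: asboolP. Qed.

Lemma ideal_zmod_closed : zmod_closed ideal.
Proof.
split=> [|x y /idealP Ix /idealP Iy]; first exact/idealP/in_ideal0.
by apply/idealP/in_ideal_add => //; rewrite -mulN1r; apply: in_idealMl.
Qed.

HB.instance Definition _ :=
  GRing.isZmodClosed.Build (free_alg F G) ideal ideal_zmod_closed.

Lemma malg_scalerAr (c : F) x y : c *: (x * y) = x * (c *: y).
Proof.
have central z : z * c%:MP = c *: z.
  rewrite malgM_def fgmulgU malgZ_def; apply: eq_bigr => k _.
  by rewrite mulm1 mulrC.
by rewrite -[c *: y]central mulrA central.
Qed.

(* A(G), the quotient of the free algebra by the ideal. *)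
Definition graph_alg : Type := Quotient.quot ideal.

HB.instance Definition _ := GRing.Zmodule.on graph_alg.

Definition graph_alg_pi : free_alg F G -> graph_alg :=
  \pi_(Quotient.quot ideal).
Local Notation ppi := graph_alg_pi.

Lemma graph_alg_piE x y : ppi x = ppi y <-> in_ideal (x - y).
Proof.
split.
  by move/eqP; rewrite -Quotient.idealrBE => /idealP.
by move=> I; apply/eqP; rewrite -Quotient.idealrBE; apply/idealP.
Qed.

Lemma graph_alg_pi_is_zmod_morphism : zmod_morphism ppi.
Proof. exact: (raddfB (\pi_(Quotient.quot ideal))). Qed.

HB.instance Definition _ := GRing.isZmodMorphism.Build
  (free_alg F G) graph_alg ppi graph_alg_pi_is_zmod_morphism.

Definition graph_alg_repr (x : graph_alg) : free_alg F G := repr x.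

Lemma graph_alg_reprK : cancel graph_alg_repr ppi.
Proof. exact: reprK. Qed.

Definition graph_alg_mul (x y : graph_alg) : graph_alg :=
  ppi (graph_alg_repr x * graph_alg_repr y).

Definition graph_alg_scale (c : F) (x : graph_alg) : graph_alg :=
  ppi (c *: graph_alg_repr x).

Lemma pi_graph_alg_mul x y : graph_alg_mul (ppi x) (ppi y) = ppi (x * y).
Proof.
apply/graph_alg_piE.
set x' := graph_alg_repr _; set y' := graph_alg_repr _.
have Ix : in_ideal (x' - x) by apply/graph_alg_piE; rewrite graph_alg_reprK.
have Iy : in_ideal (y' - y) by apply/graph_alg_piE; rewrite graph_alg_reprK.
rewrite (_ : _ - _ = x' * (y' - y) + (x' - x) * y).
  by apply: in_ideal_add; [apply: in_idealMl | apply: in_idealMr].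
by rewrite mulrBr mulrBl addrA subrK.
Qed.

Lemma pi_graph_alg_scale c x : graph_alg_scale c (ppi x) = ppi (c *: x).
Proof.
apply/graph_alg_piE; rewrite -scalerBr -mul_malgC; apply: in_idealMl.
by apply/graph_alg_piE; rewrite graph_alg_reprK.
Qed.

Lemma graph_alg_ind (P : graph_alg -> Prop) :
  (forall x, P (ppi x)) -> forall u, P u.
Proof. by move=> Pp u; rewrite -[u]graph_alg_reprK. Qed.

Fact graph_alg_mulA : associative graph_alg_mul.
Proof.
elim/graph_alg_ind=> x; elim/graph_alg_ind=> y; elim/graph_alg_ind=> z.
by rewrite !pi_graph_alg_mul mulrA.
Qed.

Fact graph_alg_mul1 : left_id (ppi 1) graph_alg_mul.
Proof. by elim/graph_alg_ind=> x; rewrite pi_graph_alg_mul mul1r. Qed.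

Fact graph_alg_mulr1 : right_id (ppi 1) graph_alg_mul.
Proof. by elim/graph_alg_ind=> x; rewrite pi_graph_alg_mul mulr1. Qed.

Fact graph_alg_mulDl : left_distributive graph_alg_mul +%R.
Proof.
elim/graph_alg_ind=> x; elim/graph_alg_ind=> y; elim/graph_alg_ind=> z.
by rewrite -raddfD !pi_graph_alg_mul mulrDl raddfD.
Qed.

Fact graph_alg_mulDr : right_distributive graph_alg_mul +%R.
Proof.
elim/graph_alg_ind=> x; elim/graph_alg_ind=> y; elim/graph_alg_ind=> z.
by rewrite -raddfD !pi_graph_alg_mul mulrDr raddfD.
Qed.

Fact graph_alg_1neq0 : ppi 1 != 0.
Proof.
apply/eqP; rewrite -[0](raddf0 ppi) => /graph_alg_piE.
by rewrite subr0; apply: in_ideal_proper.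
Qed.

HB.instance Definition _ := GRing.Zmodule_isNzRing.Build graph_alg
  graph_alg_mulA graph_alg_mul1 graph_alg_mulr1 graph_alg_mulDl graph_alg_mulDr
  graph_alg_1neq0.

Fact graph_alg_scaleA c d (v : graph_alg) :
  graph_alg_scale c (graph_alg_scale d v) = graph_alg_scale (c * d) v.
Proof.
by elim/graph_alg_ind: v => v; rewrite !pi_graph_alg_scale scalerA.
Qed.

Fact graph_alg_scale1 : left_id 1 graph_alg_scale.
Proof. by elim/graph_alg_ind=> v; rewrite pi_graph_alg_scale scale1r. Qed.

Fact graph_alg_scaleDr : right_distributive graph_alg_scale +%R.
Proof.
move=> c; elim/graph_alg_ind=> u; elim/graph_alg_ind=> v.
by rewrite -raddfD !pi_graph_alg_scale scalerDr raddfD.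
Qed.

Fact graph_alg_scaleDl v : {morph graph_alg_scale^~ v : c d / c + d}.
Proof.
move=> c d; elim/graph_alg_ind: v => v.
by rewrite !pi_graph_alg_scale scalerDl raddfD.
Qed.

HB.instance Definition _ := GRing.Zmodule_isLmodule.Build F graph_alg
  graph_alg_scaleA graph_alg_scale1 graph_alg_scaleDr graph_alg_scaleDl.

Fact graph_alg_scaleAl (c : F) (u v : graph_alg) : c *: (u * v) = (c *: u) * v.
Proof.
elim/graph_alg_ind: u => u; elim/graph_alg_ind: v => v.
rewrite /GRing.scale /GRing.mul /= !(pi_graph_alg_mul, pi_graph_alg_scale).
by rewrite scalerAl.
Qed.

HB.instance Definition _ :=
  GRing.Lmodule_isLalgebra.Build F graph_alg graph_alg_scaleAl.

Fact graph_alg_scaleAr (c : F) (u v : graph_alg) : c *: (u * v) = u * (c *: v).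
Proof.
elim/graph_alg_ind: u => u; elim/graph_alg_ind: v => v.
rewrite /GRing.scale /GRing.mul /= !(pi_graph_alg_mul, pi_graph_alg_scale).
by rewrite malg_scalerAr.
Qed.

HB.instance Definition _ :=
  GRing.Lalgebra_isAlgebra.Build F graph_alg graph_alg_scaleAr.

Fact graph_alg_pi_is_monoid_morphism : monoid_morphism ppi.
Proof. by split=> // x y; rewrite -pi_graph_alg_mul. Qed.

HB.instance Definition _ := GRing.isMonoidMorphism.Build
  (free_alg F G) graph_alg ppi graph_alg_pi_is_monoid_morphism.

Fact graph_alg_pi_is_scalable : scalable ppi.
Proof. by move=> c x; rewrite -pi_graph_alg_scale. Qed.

HB.instance Definition _ := GRing.isScalable.Build
  F (free_alg F G) graph_alg *:%R ppi graph_alg_pi_is_scalable.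

(* The component A_n: the classes of the linear combinations of words of
   length n. *)
Definition graph_alg_deg (n : nat) (a : graph_alg) : Prop :=
  exists2 x : free_alg F G,
    forall m : {fmonom (edge G)}, mcoeff m x != 0 -> size m = n & a = ppi x.

End GraphAlgebra.

(** * Hilbert series and Koszulness *)

(* The subspace [{v | S v}] of V has dimension d. *)
Definition has_dim (F : fieldType) (V : lmodType F) (S : V -> Prop) (d : nat) :
    Prop :=
  exists s : 'I_d -> V,
    [/\ forall i, S (s i),
        forall v, S v -> exists c : 'I_d -> F, v = \sum_i c i *: s i &
        forall c : 'I_d -> F, \sum_i c i *: s i = 0 -> forall i, c i = 0].

(* The n-th coefficient of the product of the polynomial p and the power series
   \sum_n h n * t^n. *)
Definition poly_mul_series (p : {poly int}) (h : nat -> nat) (n : nat) : int :=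
  \sum_(i < n.+1) p`_i * (h (n - i)%N)%:Z.

Section GradedAlgebra.
(* [gr n] is the component of degree n of a graded algebra A. *)
Variables (F : fieldType) (A : algType F) (gr : nat -> A -> Prop).

(* The power series \sum_n dim(A_n) t^n exists, i.e., all the A_n have finite
   dimension, and it is the inverse of the power series p. *)
Definition hilbert_series_inv_of (p : {poly int}) : Prop :=
  exists h : nat -> nat,
    (forall n, has_dim (gr n) (h n)) /\
    (forall n, poly_mul_series p h n = (n == 0%N)%:Z).

(* The augmentation ideal A_+, the sum of the A_n with n > 0. *)
Definition positive_part (a : A) : Prop :=
  exists (k : nat) (x : 'I_k -> A),
    (forall i : 'I_k, gr i.+1 (x i)) /\ a = \sum_i x i.

Definition res_rank (b : nat -> nat) (i : nat) : nat :=
  if i is j.+1 then b j else 1%N.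

(* The graded algebra A, with A_0 = F and all A_n of finite dimension, is
   Koszul: the trivial left module F = A/A_+ has a resolution
     ... -> P_2 -> P_1 -> P_0 = A -> F -> 0
   by graded free modules, P_i being free on finitely many generators of degree
   i. Such a P_i is the module of row vectors with entries in A, and since the
   differentials preserve degrees, they are the maps v |-> v *m D i where the
   entries of the matrix D i have degree 1. This is the vanishing of
   Tor^A_{i,j}(F, F) for i <> j, and it forces A to be quadratic. *)
Definition koszul : Prop :=
  exists (b : nat -> nat)
         (D : forall i, 'M[A]_(res_rank b i.+1, res_rank b i)),
    [/\ forall i j k, gr 1%N (D i j k),
        forall a : A, positive_part a <->
          exists u : 'rV[A]_(res_rank b 1), (u *m D 0%N : 'rV[A]_1) 0 0 = a &
        forall i (v : 'rV[A]_(res_rank b i.+1)),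
          v *m D i = 0 <->
          exists u : 'rV[A]_(res_rank b i.+2), u *m D i.+1 = v].

End GradedAlgebra.

(* Main.v *)
From HB Require Import structures.
Require Import Defs.
From mathcomp Require Import all_boot all_order all_algebra.
From mathcomp Require Import finmap zify.
From mathcomp Require Import monalg.

Set Implicit Arguments.
Unset Strict Implicit.
Unset Printing Implicit Defensive.

Import GRing.Theory.

Local Open Scope ring_scope.

(** Let x_v be the sum of the edges along a path from v down to the minimal
    vertex; it does not depend on the path, the edge from v to w is x_v - x_w,
    and the x_v with v above the minimal vertex generate the algebra.

    The graph has W1, W2, W3 in layer 1 and Top alone in layer 3.  Top covers
    only VQ and VV, which form a 4-cycle with W1 and W2; the remaining vertices
    VT (over W1, W2, W3) and VS i (over W1 and W2, and over W3 when i < 2) of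
    layer 2 are not below Top.  The 4-cycle is responsible for the cubic term of
    the Hilbert series, and the r - 6 vertices VT and VS i have degrees such
    that there are r generators and r relations.  In the basis
      a = x_W1, d = x_W1 - x_W2, c = x_W1 - x_W3, V = x_VV - x_W1,
      q = x_VQ - x_VV, T = x_VT - x_W1, S_i = x_(VS i) - x_VT, U = x_Top - x_VQ
    the relations of the algebra become
      U q = q V,  q d = 0,  V d = T d = d (a - d),  T c = c (a - c),
      S_i d = 0,  S_0 c = S_1 c = 0,
    all of the form p x = x (linear form).  Read from left to right they are a
    rewriting system whose only overlap U q d is confluent, since
    q V d = q d (a - d) = 0.  Hence the words without a left-hand side as a
    factor, the normal words, form a basis, and their number h_n satisfies
    h_(n+3) - r h_(n+2) + r h_(n+1) - h_n = 0 ([count_normalSSS]).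

    Confluence is proved by letting each letter act on the right on the space of
    all words, by the recursion [rword] that carries a letter to the left through
    left-hand sides; [rmul_rmul] says that these operators satisfy the relations.
    The orbit map of the empty word is then a normal form map [nf] on the
    algebra, and the evaluation of words [eval] is a left inverse of it ([nfK]).
    That the relations of the graph act trivially ([kills_relator]) is checked
    only on paths of two edges: two paths of three edges are joined by switching
    one middle vertex at a time.

    The minimal resolution is 0 -> A -> A^r -> A^r -> A, with one basis element
    for the empty word, for each letter, for each relation and for the overlap.
    Exactness is read off from the last letters of normal forms: modulo the
    relations the coefficient of a letter x can be chosen so that x can be
    appended to its normal form without rewriting ([reduced_decompose]), and then
    different letters cannot cancel ([reduced_free], [exact_relations]).  The
    only syzygy comes from rewriting U q d in two ways ([exact_syzygies]). *)

(** * Linear extension and supports in monoid algebras *)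
Section LinearExtension.
Variables (F : fieldType) (K : choiceType) (V : lmodType F).

Definition linext (f : K -> V) (z : {malg F[K]}) : V :=
  \sum_(k <- msupp z) z@_k *: f k.

Lemma linextEw f (D : {fset K}) z :
  (msupp z `<=` D)%fset -> linext f z = \sum_(k <- D) z@_k *: f k.
Proof.
move=> le; rewrite [LHS](big_fset_incl _ le) => //= k kD /mcoeff_outdom ->.
by rewrite scale0r.
Qed.

Lemma linext_is_linear f : linear (linext f).
Proof.
move=> c x y /=.
pose D := (msupp x `|` msupp y)%fset.
rewrite !(@linextEw f D) ?fsubsetUl ?fsubsetUr //.
  rewrite scaler_sumr -big_split /=; apply: eq_bigr => k _.
  by rewrite mcoeffD mcoeffZ scalerDl scalerA.
apply: fsubset_trans (msuppD_le _ _) _.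
by apply: fsetUSS => //; exact: msuppZ_le.
Qed.

HB.instance Definition _ f := GRing.isLinear.Build F {malg F[K]} V _ (linext f)
  (linext_is_linear f).

Lemma linextU f k : linext f << k >> = f k.
Proof. by rewrite (linextEw _ msuppU_le) big_seq_fset1 mcoeffUU scale1r. Qed.

Lemma malg_sumE (z : {malg F[K]}) : z = \sum_(k <- msupp z) z@_k *: << k >>.
Proof.
rewrite {1}[z]monalgE; apply: eq_bigr => k _; apply/malgP => k'.
by rewrite mcoeffZ !mcoeffU mulrnAr mulr1.
Qed.

Lemma eq_linear_on_basis (f g : {linear {malg F[K]} -> V}) :
  (forall k, f << k >> = g << k >>) -> f =1 g.
Proof.
move=> fg z; rewrite [z]malg_sumE !linear_sum; apply: eq_bigr => k _.
by rewrite !linearZ fg.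
Qed.

Lemma eq_on_basis (f g : {malg F[K]} -> V) : linear f -> linear g ->
  (forall k, f << k >> = g << k >>) -> f =1 g.
Proof.
move=> lf lg.
pose f' : {linear _ -> _} := HB.pack f (GRing.isLinear.Build _ _ _ _ f lf).
pose g' : {linear _ -> _} := HB.pack g (GRing.isLinear.Build _ _ _ _ g lg).
exact: (@eq_linear_on_basis f' g').
Qed.

End LinearExtension.

Definition supported (G : zmodType) (K : choiceType) (P : K -> Prop)
  (z : {malg G[K]}) : Prop := forall k, z@_k != 0 -> P k.

Section Supported.
Variables (F : fieldType) (K : choiceType).
Implicit Types (P : K -> Prop) (x y z : {malg F[K]}).

Lemma supported0 P : supported P (0 : {malg F[K]}).
Proof. by move=> k; rewrite mcoeff0 eqxx. Qed.

Lemma supportedD P x y : supported P x -> supported P y -> supported P (x + y).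
Proof.
move=> Px Py k; rewrite mcoeffD; have [x0|/Px //] := eqVneq (x@_k) 0.
by rewrite x0 add0r => /Py.
Qed.

Lemma supportedZ P c z : supported P z -> supported P (c *: z).
Proof. by move=> Pz k; rewrite mcoeffZ mulf_eq0 negb_or => /andP[_ /Pz]. Qed.

Lemma supportedN P z : supported P z -> supported P (- z).
Proof. by move=> Pz k; rewrite mcoeffN oppr_eq0; exact: Pz. Qed.

Lemma supported_sum P (I : Type) (s : seq I) (Q : pred I) (f : I -> {malg F[K]}) :
  (forall i, Q i -> supported P (f i)) -> supported P (\sum_(i <- s | Q i) f i).
Proof.
by move=> Pf; elim/big_ind: _ => //; [exact: supported0 | exact: supportedD].
Qed.

Lemma supportedU P k : P k -> supported P (<< k >> : {malg F[K]}).
Proof.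
by move=> Pk k'; rewrite mcoeffU; case: (eqVneq k k') => [<- //|_]; rewrite eqxx.
Qed.

Lemma supported_expand (s : seq K) z :
  uniq s -> supported (fun k => k \in s) z -> z = \sum_(k <- s) z@_k *: << k >>.
Proof.
move=> us sz; apply/malgP => k; rewrite raddf_sum /=.
have [ks|kns] := boolP (k \in s).
  rewrite (bigD1_seq k) //= mcoeffZ mcoeffUU mulr1 big1 ?addr0 // => j jk.
  by rewrite mcoeffZ mcoeffU (negPf jk) mulr0.
rewrite big1_seq => [|j /= js].
  by apply/eqP; apply: contraNT kns => /sz.
rewrite mcoeffZ mcoeffU; case: eqVneq js => [-> /(negP kns) //|_ _].
by rewrite mulr0.
Qed.

End Supported.

Lemma supported_linext (F : fieldType) (K K' : choiceType) (P : K -> Prop)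
    (Q : K' -> Prop) (f : K -> {malg F[K']}) z :
  (forall k, P k -> supported Q (f k)) -> supported P z -> supported Q (linext f z).
Proof.
move=> Pf Pz; rewrite /linext big_seq; apply: supported_sum => k.
by rewrite -mcoeff_neq0 => /Pz Pk; apply: supportedZ; apply: Pf.
Qed.

(** * Letters, relations and the right action on words *)
Section Letters.
Variable m : nat.

(** The constructors are the generators U, q, V, T, a, d, c and S_i; for the
    graph algebra of parameter m they are x_Top - x_VQ, x_VQ - x_VV, and so on. *)
Inductive letter := LU | Lq | LV | LT | La | Ld | Lc | LS of 'I_m.+2.

Definition letter_code (x : letter) : 'I_7 + 'I_m.+2 :=
  match x with
  | LU => inl (@Ordinal 7 0 isT) | Lq => inl (@Ordinal 7 1 isT)
  | LV => inl (@Ordinal 7 2 isT) | LT => inl (@Ordinal 7 3 isT)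
  | La => inl (@Ordinal 7 4 isT) | Ld => inl (@Ordinal 7 5 isT)
  | Lc => inl (@Ordinal 7 6 isT) | LS i => inr i
  end.

Definition letter_decode (u : 'I_7 + 'I_m.+2) : letter :=
  match u with
  | inl j => nth LU [:: LU; Lq; LV; LT; La; Ld; Lc] j
  | inr i => LS i
  end.

Lemma letter_codeK : cancel letter_code letter_decode.
Proof. by case. Qed.

HB.instance Definition _ := Finite.copy letter (can_type letter_codeK).

Lemma big_letter (R : Type) (idx : R) (op : Monoid.com_law idx) (f : letter -> R) :
  \big[op/idx]_x f x =
  op (f LU) (op (f Lq) (op (f LV) (op (f LT) (op (f La) (op (f Ld) (op (f Lc)
    (\big[op/idx]_i f (LS i)))))))).
Proof.
pose s := [:: LU; Lq; LV; LT; La; Ld; Lc] ++ [seq LS i | i <- index_enum 'I_m.+2].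
transitivity (\big[op/idx]_(x <- s) f x).
  apply/perm_big/uniq_perm; first exact: index_enum_uniq.
    rewrite cat_uniq map_inj_uniq ?index_enum_uniq => [|i j [] //].
    rewrite andbT; apply/andP; split=> //.
    by apply/hasPn => x /mapP[i _ ->].
  move=> x; rewrite mem_index_enum; symmetry; rewrite mem_cat.
  case: x => // i; apply/orP; right; apply: map_f; exact: mem_index_enum.
by rewrite big_cat big_map !big_cons big_nil /= Monoid.mulm1 !Monoid.mulmA.
Qed.

Lemma card_letter : #|{: letter}| = (m + 9)%N.
Proof. by rewrite -sum1_card big_letter /= sum1_card card_ord; lia. Qed.

(** The left-hand sides p x of the relations. *)
Definition forbidden (p x : letter) : bool :=
  match p, x with
  | LU, Lq | Lq, Ld | LV, Ld | LT, Ld | LT, Lc | LS _, Ld => true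
  | LS i, Lc => i < 2
  | _, _ => false
  end%N.

Variable F : fieldType.

(** The relation with left-hand side p x reads
    p x = x * (sum over y of sigma p x y * y). *)
Definition sigma (p x y : letter) : F :=
  match p, x, y with
  | LU, Lq, LV | LV, Ld, La | LT, Ld, La | LT, Lc, La => 1
  | LV, Ld, Ld | LT, Ld, Ld | LT, Lc, Lc => -1
  | _, _, _ => 0
  end.

(** The letters in which a word of the normal form of w x can end: x itself or
    the last letter of a right-hand side. *)
Definition ends (x e : letter) : bool :=
  (e == x) ||
  match x, e with Lq, LV | Ld, La | Lc, La => true | _, _ => false end.

Lemma ends_sigma p x y : sigma p x y != 0 -> ends x y.
Proof.
by case: p => [||||||| i]; case: x => [||||||| j]; case: y => [||||||| k] //=;
  rewrite /ends ?eqxx.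
Qed.

(** Once x has moved to the left of p, the linear form of the relation can be
    appended without rewriting, so one pass of [rword] reaches a normal form. *)
Lemma ends_good p x y e :
  forbidden p x -> sigma p x y != 0 -> ends x e -> ~~ forbidden e y.
Proof.
case: p => [||||||| i]; case: x => [||||||| j] //; case: y => [||||||| k] //=;
  rewrite ?eqxx //; case: e => [||||||| l] //=; rewrite /ends orbF //.
Qed.

(** Rewriting creates no new obstruction: if appending z after the normal form
    of w y may require rewriting, then so does appending z after y. *)
Lemma forbidden_ends y e z : ends y e -> forbidden e z -> forbidden y z.
Proof.
rewrite /ends => /orP[/eqP -> //|].
by case: y => [||||||| i]; case: e => [||||||| j] //; case: z => [||||||| k].
Qed.

Notation W := {malg F[seq letter]}.

(** Words are stored reversed, the head of the list being the last letter.  The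
   operators below are locked because unification would otherwise compare two
   linear extensions by unfolding them. *)
Fact snoc_key : unit. Proof. by []. Qed.
Definition snoc (x : letter) : W -> W :=
  locked_with snoc_key (linext (fun w => << x :: w >>)).

Lemma snoc_is_linear x : linear (snoc x).
Proof. by rewrite /snoc locked_withE; exact: linext_is_linear. Qed.

HB.instance Definition _ x := GRing.isLinear.Build F W W _ (snoc x)
  (@snoc_is_linear x).

(** The normal form of w x: while x meets a left-hand side p x it moves to the
    left of p, and the linear form of the relation is appended. *)
Fixpoint rword (x : letter) (w : seq letter) : W :=
  match w with
  | [::] => << [:: x] >>
  | p :: w' =>
    if forbidden p x then \sum_y sigma p x y *: snoc y (rword x w')
    else << x :: w >>
  end.

Fact rmul_key : unit. Proof. by []. Qed.
Definition rmul (x : letter) : W -> W :=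
  locked_with rmul_key (linext (rword x)).

Lemma rmul_is_linear x : linear (rmul x).
Proof. by rewrite /rmul locked_withE; exact: linext_is_linear. Qed.

HB.instance Definition _ x := GRing.isLinear.Build F W W _ (rmul x)
  (@rmul_is_linear x).

Fact strip_key : unit. Proof. by []. Qed.
(** The part of z made of the words ending in x, with this last letter removed. *)
Definition strip (x : letter) : W -> W := locked_with strip_key
  (linext (fun w => if w is y :: w' then if y == x then << w' >> else 0 else 0)).

Lemma strip_is_linear x : linear (strip x).
Proof. by rewrite /strip locked_withE; exact: linext_is_linear. Qed.

HB.instance Definition _ x := GRing.isLinear.Build F W W _ (strip x)
  (@strip_is_linear x).

Lemma snocU x w : snoc x << w >> = << x :: w >>.
Proof. by rewrite /snoc locked_withE linextU. Qed.

Lemma rmulU x w : rmul x << w >> = rword x w.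
Proof. by rewrite /rmul locked_withE linextU. Qed.

Lemma stripU x y w : strip x << y :: w >> = if y == x then << w >> else 0.
Proof. by rewrite /strip locked_withE linextU. Qed.

Lemma strip_nil x : strip x << [::] >> = 0.
Proof. by rewrite /strip locked_withE linextU. Qed.

Lemma strip_snoc x y z : strip x (snoc y z) = if y == x then z else 0.
Proof.
case: eqP => [<-|/eqP yx].
  have /= := @eq_linear_on_basis _ _ _ (strip y \o snoc y) idfun.
  by apply=> k /=; rewrite snocU stripU eqxx.
have /= := @eq_linear_on_basis _ _ _ (strip x \o snoc y) \0.
by apply=> k /=; rewrite snocU stripU (negPf yx).
Qed.

Lemma rmul_snoc_bad p x z :
  forbidden p x -> rmul x (snoc p z) = \sum_y sigma p x y *: snoc y (rmul x z).
Proof.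
move=> b; pose f z := \sum_y sigma p x y *: snoc y (rmul x z).
have lf : linear f.
  move=> c u v; rewrite /f scaler_sumr -big_split /=; apply: eq_bigr => y _.
  by rewrite !linearP.
pose g : {linear W -> W} := HB.pack f (GRing.isLinear.Build _ _ _ _ f lf).
have /= := @eq_linear_on_basis _ _ _ (rmul x \o snoc p) g.
apply=> k /=; rewrite snocU rmulU /= b /f; apply: eq_bigr => y _.
by rewrite rmulU.
Qed.

Lemma rmul_snoc_good p x z : ~~ forbidden p x -> rmul x (snoc p z) = snoc x (snoc p z).
Proof.
move=> /negPf b.
have /= := @eq_linear_on_basis _ _ _ (rmul x \o snoc p) (snoc x \o snoc p).
by apply=> k /=; rewrite !snocU rmulU /= b.
Qed.

Lemma word_decompose z : z = z@_[::] *: << [::] >> + \sum_p snoc p (strip p z).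
Proof.
pose f z := z@_[::] *: << [::] >> + \sum_p snoc p (strip p z).
have lf : linear f.
  move=> c u v; rewrite /f mcoeffD mcoeffZ scalerDl -scalerA scalerDr addrACA.
  congr (_ + _); rewrite scaler_sumr -big_split /=; apply: eq_bigr => p _.
  by rewrite !linearP.
pose g : {linear W -> W} := HB.pack f (GRing.isLinear.Build _ _ _ _ f lf).
have /= := @eq_linear_on_basis _ _ _ idfun g.
apply=> -[|x k] /=; rewrite /f.
  rewrite mcoeffUU scale1r big1 ?addr0 // => p _.
  by rewrite strip_nil linear0.
rewrite mcoeffU /= scale0r add0r (bigD1 x) //= stripU eqxx snocU.
rewrite big1 ?addr0 // => p px; by rewrite stripU eq_sym (negPf px) linear0.
Qed.

Lemma strip_rmul e x z : ~~ ends x e -> strip e (rmul x z) = 0.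
Proof.
move=> ne; have /= := @eq_linear_on_basis _ _ _ (strip e \o rmul x) \0.
apply=> k /=; rewrite rmulU.
have xe : (x == e) = false.
  by apply/negbTE/eqP => E; rewrite /ends E eqxx in ne.
case: k => [|p k] /=; first by rewrite stripU xe.
case: ifP => b; last by rewrite stripU xe.
rewrite linear_sum big1 // => y _; rewrite linearZ /= strip_snoc.
case: eqP => [ye|]; last by rewrite scaler0.
have [->|/ends_sigma] := eqVneq (sigma p x y) 0; first by rewrite scale0r.
by rewrite ye (negPf ne).
Qed.

(** x can be appended to z without rewriting. *)
Definition reduced (x : letter) (z : W) := forall p, forbidden p x -> strip p z = 0.

Lemma rmul_reduced x z : reduced x z -> rmul x z = snoc x z.
Proof.
move=> rz; rewrite [z]word_decompose !linearD !linearZ /= rmulU snocU /=.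
congr (_ + _); rewrite !linear_sum; apply: eq_bigr => p _ /=.
have [b|b] := boolP (forbidden p x); first by rewrite rz // !linear0.
exact: rmul_snoc_good.
Qed.

(** When no left-hand side ends in p there is no overlap to resolve: p is just
    appended, and the next letter rewrites it. *)
Lemma rmul_rmul_free p x z :
    forbidden p x -> (forall e, ~~ forbidden e p) ->
  rmul x (rmul p z) = \sum_y sigma p x y *: rmul y (rmul x z).
Proof.
move=> b fp; rewrite (rmul_reduced (x := p)); last by move=> e; rewrite (negPf (fp e)).
rewrite (rmul_snoc_bad _ b); apply: eq_bigr => y _.
have [->|s] := eqVneq (sigma p x y) 0; first by rewrite !scale0r.
congr (_ *: _); rewrite [RHS]rmul_reduced // => e be; apply: strip_rmul.
by apply: contraL be; apply: ends_good s.
Qed.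

(** The overlap U q d: if w does not end in U, appending q to w U^n gives
    w q V^n, and d moves left through the letters V until it meets q. *)
Lemma rmul_d_rmul_q z : rmul Ld (rmul Lq z) = 0.
Proof.
have rdq w : rmul Ld (rword Lq w) = 0.
  elim: w => [|p w IH] /=; first by rewrite rmulU /= big1 // => y _; rewrite scale0r.
  case: ifP => b; last by rewrite rmulU /= big1 // => y _; rewrite scale0r.
  rewrite linear_sum big1 // => y _; rewrite linearZ /=.
  have [->|s] := eqVneq (sigma p Lq y) 0; first by rewrite scale0r.
  suff -> : y = LV.
    by rewrite rmul_snoc_bad // IH big1 ?scaler0 // => y' _; rewrite linear0 scaler0.
  by case: p y s b => [||||||| i] [||||||| j] //=; rewrite eqxx.
have /= := @eq_linear_on_basis _ _ _ (rmul Ld \o rmul Lq) \0.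
by apply=> k /=; rewrite rmulU.
Qed.

(** The operators [rmul] satisfy the relations, so that words carry a right
    action of every algebra presented by them. *)
Lemma rmul_rmul p x z :
  forbidden p x -> rmul x (rmul p z) = \sum_y sigma p x y *: rmul y (rmul x z).
Proof.
have [->|pq] := eqVneq p Lq => b; last first.
  apply: (rmul_rmul_free _ b) => e.
  by case: p x e b pq => [||||||| i] [||||||| j] [||||||| k].
case: x b => // _; rewrite rmul_d_rmul_q big1 // => y _.
by rewrite scale0r.
Qed.

(** * Counting normal words *)
Definition appendable (w : seq letter) (x : letter) : bool :=
  if w is p :: _ then ~~ forbidden p x else true.

Fixpoint normal_words (n : nat) : seq (seq letter) :=
  if n is n'.+1 then
    [seq x :: w | w <- normal_words n',
                  x <- [seq x <- enum {: letter} | appendable w x]]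
  else [:: [::]].

Lemma normal_words_cons n x w :
  (x :: w \in normal_words n.+1) = (w \in normal_words n) && appendable w x.
Proof.
apply/allpairsPdep/andP => [[w' [x' [ww' + [-> ->]]]]|[ww aw]].
  by rewrite mem_filter => /andP[].
by exists w, x; rewrite mem_filter mem_enum aw.
Qed.

Lemma normal_words_nil n : ([::] \in normal_words n.+1) = false.
Proof. by apply/negbTE/allpairsPdep => -[w [x []]]. Qed.

Lemma normal_words_uniq n : uniq (normal_words n).
Proof.
elim: n => //= n IH; apply: allpairs_uniq_dep => // [w _|].
  by rewrite filter_uniq ?enum_uniq.
by move=> [w x] [w' x'] /= _ _ [-> ->].
Qed.

Lemma normal_words_size n w : w \in normal_words n -> size w = n.
Proof.
elim: n w => [|n IH] [|x w] //; first by rewrite normal_words_nil.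
by rewrite normal_words_cons => /andP[/IH /= -> _].
Qed.

Lemma rword_appendable x w : appendable w x -> rword x w = << x :: w >>.
Proof. by case: w => //= p w /negPf ->. Qed.

Lemma rword_size x w : supported (fun k => size k = (size w).+1) (rword x w).
Proof.
elim: w => [|p w IH]; first exact: supportedU.
rewrite [rword _ _]/=; case: ifP => _; last exact: supportedU.
apply: supported_sum => y _; apply: supportedZ.
rewrite /snoc locked_withE; apply: supported_linext IH => k kw.
by apply: supportedU; rewrite /= kw.
Qed.

(** The statement on last letters is what the induction needs in order to append
   the letters of a right-hand side. *)
Lemma rword_normal x n w : w \in normal_words n ->
  supported (fun k => (k \in normal_words n.+1) /\
    if k is e :: _ then ends x e : Prop else False) (rword x w).
Proof.
elim: w n => [|p w IH] [|n] //.
- by move=> _; apply: supportedU; split; rewrite ?normal_words_cons /ends ?eqxx.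
- by rewrite normal_words_nil.
move=> nw; rewrite [rword _ _]/=; case: ifP => b; last first.
  apply: supportedU; split; last by rewrite /ends eqxx.
  by rewrite normal_words_cons nw /= b.
move: nw; rewrite normal_words_cons => /andP[nw _].
apply: supported_sum => y _.
have [->|s] := eqVneq (sigma p x y) 0; first by rewrite scale0r; exact: supported0.
apply: supportedZ; rewrite /snoc locked_withE.
apply: supported_linext (IH _ nw) => -[|e k] // [nk ek].
  by case: nk.
apply: supportedU; split.
  by rewrite normal_words_cons nk /=; exact: ends_good b s ek.
exact: ends_sigma s.
Qed.

Definition word_sum (n : nat) (f : seq letter -> nat) : nat :=
  (\sum_(w <- normal_words n) f w)%N.

Definition ends_with (p : letter) (w : seq letter) : nat :=
  if w is x :: _ then (x == p)%N else 0%N.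

Lemma word_sumS n f : word_sum n.+1 f =
  word_sum n (fun w => \sum_(x | appendable w x) f (x :: w))%N.
Proof.
rewrite /word_sum /= big_allpairs_dep; apply: eq_bigr => w _.
by rewrite big_filter big_enum_cond.
Qed.

(** Only the last letter of w can prevent x from being appended. *)
Lemma appendableE w x :
  (appendable w x + \sum_(p | forbidden p x) ends_with p w = 1)%N.
Proof.
case: w => [|y w] /=; first by rewrite big1.
case: (boolP (forbidden y x)) => b /=.
  by rewrite (bigD1 y) //= eqxx big1 // => p /andP[_ /negPf]; rewrite eq_sym => ->.
rewrite big1 // => p bp; case: eqP => // yp; by rewrite yp bp in b.
Qed.

Local Notation h n := (size (normal_words n)).
Local Notation hw p n := (word_sum n (ends_with p)).

Lemma word_sum1 n : word_sum n (fun=> 1%N) = h n.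
Proof. by rewrite /word_sum sum1_size. Qed.

(** A word ending in p is a shorter word to which p could be appended. *)
Lemma count_endingS p n : (hw p n.+1 + \sum_(p' | forbidden p' p) hw p' n = h n)%N.
Proof.
rewrite -word_sum1 word_sumS /word_sum exchange_big -big_split /=.
apply: eq_bigr => w _; rewrite -[RHS](appendableE w p); congr addn.
rewrite big_mkcond (bigD1 p) //= eqxx big1 ?addn0; first by case: ifP.
by move=> x /negPf ->; case: ifP.
Qed.

(** Of the m + 9 ways to extend each normal word, those that create a left-hand
    side p x are counted by the normal words ending in p. *)
Lemma count_normalS n :
  (h n.+1 + \sum_x \sum_(p | forbidden p x) hw p n = (m + 9) * h n)%N.
Proof.
rewrite -!word_sum1 word_sumS /word_sum.
rewrite (eq_bigr (fun x =>
    \sum_(w <- normal_words n) \sum_(p | forbidden p x) ends_with p w)%N); last first.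
  by move=> x _; rewrite exchange_big.
rewrite exchange_big -big_split big_distrr /=; apply: eq_bigr => w _.
rewrite muln1 -card_letter -sum1_card big_mkcond -big_split /=.
apply: eq_bigr => x _; rewrite -[RHS](appendableE w x).
by case: (appendable w x).
Qed.

Lemma count_ending_free p n : (forall e, ~~ forbidden e p) -> hw p n.+1 = h n.
Proof.
by move=> fp; rewrite -(count_endingS p) big_pred0 ?addn0 // => e; exact/negbTE.
Qed.

Lemma count_ending_q n : (hw Lq n.+1 + hw LU n = h n)%N.
Proof.
rewrite -[RHS](count_endingS Lq); congr addn.
rewrite (bigD1 LU) //= big1 ?addn0 // => p; by case: p => [||||||| i].
Qed.

(** All m + 8 relations but q d = 0 start with a letter in which no left-hand side
    ends; the words ending in such a letter are counted by [count_ending_free]. *)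
Lemma count_normalSS n : (h n.+2 + (m + 8) * h n + hw Lq n.+1 = (m + 9) * h n.+1)%N.
Proof.
have f p : (forall e, ~~ forbidden e p) -> hw p n.+1 = h n by exact: count_ending_free.
rewrite -count_normalS -addnA; congr addn.
rewrite big_letter /= !(big_mkcond (fun p => forbidden p _)) /= !big_letter /=.
rewrite !big1_eq ?addn0 ?add0n.
have fU : hw LU n.+1 = h n by apply: f => -[].
have fV : hw LV n.+1 = h n by apply: f => -[].
have fT : hw LT n.+1 = h n by apply: f => -[].
have fS i : hw (LS i) n.+1 = h n by apply: f => -[].
rewrite fU fV fT.
rewrite (eq_bigr (fun=> h n)) ?sum_nat_const ?card_ord => [|i _]; last exact: fS.
rewrite !big_ord_recl /= !fS big1_eq.
lia.
Qed.

Lemma count_normal0 : h 0 = 1%N. Proof. by []. Qed.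

Lemma count_normal1 : h 1 = (m + 9)%N.
Proof.
have := count_normalS 0; rewrite count_normal0 muln1 big1 ?addn0 // => x _.
by rewrite big1 // => p _; rewrite /word_sum /= big_seq1.
Qed.

Lemma count_normal2 : (h 2 + (m + 9) * h 0 = (m + 9) * h 1)%N.
Proof.
have q1 : hw Lq 1 = 1%N.
  by have := count_ending_q 0; rewrite {2}/word_sum /= big_seq1 addn0.
by have := count_normalSS 0; rewrite count_normal0 q1; lia.
Qed.

Lemma count_normalSSS n : (h n.+3 + (m + 9) * h n.+1 = (m + 9) * h n.+2 + h n)%N.
Proof.
have := count_ending_q n.+1; rewrite (@count_ending_free LU) => [|[] //].
have := count_normalSS n.+1; rewrite !mulnDl; lia.
Qed.

End Letters.

(** Expanding the product of 1 - r t + r t^2 - t^3 with the series of the h n. *)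
Lemma inverse_of_recurrence (r : nat) (h : nat -> nat) :
    h 0%N = 1%N -> h 1%N = r -> (h 2 + r * h 0 = r * h 1)%N ->
    (forall n, h n.+3 + r * h n.+1 = r * h n.+2 + h n)%N ->
  forall n, poly_mul_series (1 - r%:R *: 'X + r%:R *: 'X^2 - 'X^3) h n = (n == 0%N)%:Z.
Proof.
move=> h0 h1 h2 h3 n; rewrite /poly_mul_series.
pose p : {poly int} := 1 - r%:R *: 'X + r%:R *: 'X^2 - 'X^3; rewrite -/p.
have pE i : p`_i = nth 0 [:: 1; - r%:Z; r%:Z; -1] i.
  rewrite /p !coefE.
  by case: i => [|[|[|[|i]]]] /=;
    rewrite ?mulr0 ?mulr1 ?subr0 ?sub0r ?addr0 ?add0r ?oppr0 ?nth_nil ?natz.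
case: n => [|[|[|n]]].
- by rewrite big_ord1 pE /= h0.
- by rewrite !big_ord_recl big_ord0 !pE /= h1 h0; lia.
- rewrite !big_ord_recl big_ord0 !pE /= /bump /= ?add1n ?subSS ?subn0; lia.
rewrite !big_ord_recl big1 => [|i _]; last by rewrite !pE /= nth_nil mul0r.
rewrite !pE /= /bump /= ?add1n ?subSS ?subn0; have := h3 n; lia.
Qed.

(** * Algebras with the given relations and a normal form map *)
Section Model.
Variables (m : nat) (F : fieldType) (A : algType F) (L : letter m -> A).
Local Notation W := {malg F[seq (letter m)]}.
Variable phi : {linear A -> W}.

(** The head of a list being its last letter, its value is the rightmost factor. *)
Fixpoint word_value (w : seq (letter m)) : A :=
  if w is x :: w' then word_value w' * L x else 1.
Fact eval_key : unit. Proof. by []. Qed.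
Definition eval : W -> A := locked_with eval_key (linext word_value).

Lemma eval_is_linear : linear eval.
Proof. by rewrite /eval locked_withE; exact: linext_is_linear. Qed.

HB.instance Definition _ := GRing.isLinear.Build F W A _ eval eval_is_linear.

Lemma evalU w : eval << w >> = word_value w.
Proof. by rewrite /eval locked_withE linextU. Qed.

Lemma eval_nil : eval << [::] >> = 1.
Proof. exact: evalU. Qed.

Lemma eval_cons x w : eval << x :: w >> = eval << w >> * L x.
Proof. by rewrite !evalU. Qed.

Lemma eval_sumE z : eval z = \sum_(w <- msupp z) z@_w *: eval << w >>.
Proof.
by rewrite {1}[z]malg_sumE linear_sum; apply: eq_bigr => w _; rewrite linearZ.
Qed.

Hypothesis relA : forall p x, forbidden p x ->
  L p * L x = \sum_y sigma F p x y *: (L x * L y).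
Hypothesis phi1 : phi 1 = << [::] >>.
Hypothesis phiM : forall a x, phi (a * L x) = rmul x (phi a).
Hypothesis phiK : forall a, eval (phi a) = a.

Lemma eval_snoc x z : eval (snoc x z) = eval z * L x.
Proof.
move: z; apply: eq_on_basis => [c u v|c u v|k] /=.
- by rewrite !linearP.
- by rewrite linearP mulrDl scalerAl.
- by rewrite snocU eval_cons.
Qed.

(** The rewriting performed by [rmul] uses only relations that hold in A. *)
Lemma eval_rmul x z : eval (rmul x z) = eval z * L x.
Proof.
move: z; apply: eq_on_basis => [c u v|c u v|w].
- by rewrite !linearP.
- by rewrite linearP mulrDl scalerAl.
rewrite rmulU; elim: w => [|p w IH]; first exact: eval_cons.
rewrite [@rword m F x (p :: w)]/=; case: ifP => b; last exact: eval_cons.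
rewrite linear_sum eval_cons -mulrA relA // mulr_sumr; apply: eq_bigr => y _.
by rewrite linearZ /= eval_snoc IH -scalerAr mulrA.
Qed.

Lemma phi_inj : injective phi.
Proof. exact: can_inj phiK. Qed.

(** The component along p of a in the decomposition of a by last letters of its
    normal form. *)
Definition letter_coef (p : letter m) (a : A) : A := eval (strip p (phi a)).

Lemma letter_decompose a :
  a = (phi a)@_[::] *: 1 + \sum_p letter_coef p a * L p.
Proof.
rewrite -[LHS]phiK [in LHS](word_decompose (phi a)) linearD linearZ /=.
rewrite eval_nil linear_sum; congr (_ + _); apply: eq_bigr => p _.
exact: eval_snoc.
Qed.

(** * Exactness *)

(** The terms of a ending in a letter p with p x a left-hand side are split off;
    by [forbidden_ends] the normal form of the rest acquires no such terms. *)
Lemma reduced_decompose x a : exists2 n, reduced x (phi n) &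
  a = n + \sum_(p | forbidden p x) letter_coef p a * L p.
Proof.
exists ((phi a)@_[::] *: 1 + \sum_(p | ~~ forbidden p x) letter_coef p a * L p).
  move=> e be; rewrite !linearD !linearZ /= phi1 strip_nil scaler0 add0r.
  rewrite !linear_sum big1 // => p bp /=; rewrite phiM strip_rmul //.
  by apply: contra bp => ep; apply: forbidden_ends ep be.
rewrite -addrA [X in _ = _ + X]addrC {1}[a]letter_decompose.
by rewrite (bigID (fun p => forbidden p x)).
Qed.

(** Appending the letters z without rewriting yields words with distinct last
    letters, so nothing cancels. *)
Lemma reduced_free (v : letter m -> A) :
  (forall z, reduced z (phi (v z))) -> \sum_z v z * L z = 0 ->
  forall z, v z = 0.
Proof.
move=> rv s0 z; apply: phi_inj; rewrite linear0.
have /(congr1 (strip z \o phi)) /= := s0.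
rewrite !linear0 !linear_sum (bigD1 z) //= phiM rmul_reduced // strip_snoc eqxx.
rewrite big1 ?addr0 // => y yz; rewrite phiM rmul_reduced // strip_snoc.
by rewrite (negPf yz).
Qed.

(** The relation p x - x * (linear form) written as a sum of left multiples of
    the letters z. *)
Definition relation_coef (p x z : letter m) : A :=
  (if z == x then L p else 0) - sigma F p x z *: L x.

Lemma relation_coefP p x : forbidden p x -> \sum_z relation_coef p x z * L z = 0.
Proof.
move=> b; rewrite (eq_bigr (fun z => (if z == x then L p else 0) * L z -
    sigma F p x z *: (L x * L z))); last first.
  by move=> z _; rewrite mulrBl scalerAl.
rewrite sumrB -relA // (bigD1 x) //= eqxx big1 ?addr0 ?subrr // => z /negPf ->.
by rewrite mul0r.
Qed.

Lemma sum_relation_coef (g : letter m * letter m -> A) z :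
  \sum_(b | forbidden b.1 b.2) g b * relation_coef b.1 b.2 z =
  \sum_(p | forbidden p z) g (p, z) * L p -
  \sum_(b | forbidden b.1 b.2) sigma F b.1 b.2 z *: (g b * L b.2).
Proof.
rewrite (eq_bigr (fun b => (if z == b.2 then g b * L b.1 else 0) -
   sigma F b.1 b.2 z *: (g b * L b.2))); last first.
  by move=> b _; rewrite mulrBr scalerAr; case: ifP; rewrite ?mulr0.
rewrite sumrB; congr (_ - _).
rewrite -big_mkcondr /=.
rewrite (reindex_onto (fun p => (p, z)) fst) /=; last first.
  by move=> [p y] /andP[_ /eqP /= ->].
by apply: eq_bigl => p; rewrite !eqxx !andbT.
Qed.

(** Subtracting suitable multiples of the relations makes every coefficient v z
    reduced, whence zero by [reduced_free]; the terms in x * (linear form)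
    brought in by the subtraction remain reduced by [ends_good]. *)
Lemma exact_relations (v : letter m -> A) : \sum_z v z * L z = 0 ->
  exists g : letter m * letter m -> A,
    forall z, v z = \sum_(b | forbidden b.1 b.2) g b * relation_coef b.1 b.2 z.
Proof.
move=> s0; pose g b := letter_coef b.1 (v b.2); exists g => z.
pose v' z := v z - \sum_(b | forbidden b.1 b.2) g b * relation_coef b.1 b.2 z.
suff: v' z = 0 by move/eqP; rewrite subr_eq0 => /eqP.
move: z; apply: reduced_free => [z|]; last first.
  rewrite (eq_bigr (fun z => v z * L z -
    \sum_(b | forbidden b.1 b.2) g b * (relation_coef b.1 b.2 z * L z))); last first.
    move=> z _; rewrite mulrBl mulr_suml; congr (_ - _).
    by apply: eq_bigr => b _; rewrite mulrA.
  rewrite sumrB s0 exchange_big big1 ?subr0 // => b bb.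
  by rewrite -mulr_sumr relation_coefP ?mulr0.
rewrite /v' sum_relation_coef opprB addrCA.
have [n rn en] := reduced_decompose z (v z).
rewrite [X in X - _]en addrK addrC => e be.
rewrite !linearD /= rn // add0r !linear_sum big1 // => -[p x] /= b.
have [->|s] := eqVneq (sigma F p x z) 0; first by rewrite scale0r !linear0.
rewrite !linearZ /= phiM strip_rmul ?scaler0 //.
by apply: contraL be; apply: ends_good s.
Qed.

(** From the overlap U q d: the relation q d = 0 is taken U times and the
    relation V d = d (a - d) is taken - q times. *)
Definition syzygy (b : letter m * letter m) : A :=
  if b == (Lq m, Ld m) then L (LU m)
  else if b == (LV m, Ld m) then - L (Lq m) else 0.

(** Comparison of the terms with a given last letter in the columns of the
    letters z.  Every relation p z with p other than q and V gets coefficient 0,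
    since p is not the last letter of anything else.  In the column of d only
    the coefficients g (q, d) and g (V, d) remain.  Splitting off the terms of
    g (q, d) that end in U, the words ending in q show that the rest vanishes, so
    g (q, d) = h U, and those ending in V show that g (V, d) = - h q. *)
Lemma exact_syzygies (g : letter m * letter m -> A) :
  (forall z, \sum_(b | forbidden b.1 b.2) g b * relation_coef b.1 b.2 z = 0) ->
  exists u : A, forall b, forbidden b.1 b.2 -> g b = u * syzygy b.
Proof.
move=> g0.
have gE z : \sum_(p | forbidden p z) g (p, z) * L p =
   \sum_(b | forbidden b.1 b.2) sigma F b.1 b.2 z *: (g b * L b.2).
  by apply/eqP; rewrite -subr_eq0 -sum_relation_coef g0.
have strip0 z e : (forall p x, forbidden p x -> sigma F p x z != 0 -> ~~ ends x e) ->
    \sum_(p | forbidden p z) strip e (rmul p (phi (g (p, z)))) = 0.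
  move=> he; have /(congr1 (strip e \o phi)) /= := gE z.
  rewrite !linear_sum /= (eq_bigr (fun p => strip e (rmul p (phi (g (p, z)))))).
    move=> ->; rewrite big1 // => -[p x] /= b; rewrite !linearZ /= phiM.
    have [->|s] := eqVneq (sigma F p x z) 0; first by rewrite scale0r.
    by rewrite strip_rmul ?scaler0 //; apply: he b s.
  by move=> p _; rewrite phiM.
have free p z : forbidden p z -> p != Lq m -> p != LV m -> g (p, z) = 0.
  move=> b pq pV; apply: phi_inj; rewrite linear0.
  have he p' x : forbidden p' x -> ~~ ends x p.
    by case: p b pq pV => [||||||| i] //; case: x => [||||||| j] //;
      case: p' => [||||||| k].
  have := strip0 z p (fun p' x b' _ => he p' x b').
  rewrite (bigD1 p) //= big1 ?addr0 => [|e /andP[be ep]].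
    rewrite rmul_reduced ?strip_snoc ?eqxx // => e.
    by case: p b pq pV {he} => [||||||| i] //; case: e => [||||||| j].
  rewrite strip_rmul //; apply: contra ep; rewrite /ends.
  by case: p b pq pV {he} => [||||||| i] // _ _ _; case: e be => [||||||| j];
    rewrite ?orbF // eq_sym.
have gd e : (forall p x, forbidden p x -> sigma F p x (Ld m) != 0 -> ~~ ends x e) ->
    strip e (rmul (Lq m) (phi (g (Lq m, Ld m)))) +
    strip e (snoc (LV m) (phi (g (LV m, Ld m)))) = 0.
  move=> /strip0; rewrite (bigD1 (Lq m)) //= (bigD1 (LV m)) //= big1 ?addr0.
    by rewrite [rmul (LV m) _]rmul_reduced // => -[].
  by move=> p /andP[/andP[b pq] pV]; rewrite free // !linear0.
have [n rn gqE] := reduced_decompose (Lq m) (g (Lq m, Ld m)).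
set h := letter_coef (LU m) (g (Lq m, Ld m)).
have {}gqE : g (Lq m, Ld m) = n + h * L (LU m).
  rewrite {1}gqE (bigD1 (LU m)) //= big1 ?addr0 // => p.
  by case: p => [||||||| i].
have sd p x e : forbidden p x -> sigma F p x (Ld m) != 0 ->
    ~~ ends (Ld m) e -> ~~ ends x e.
  by case: p => [||||||| i]; case: x => [||||||| j] //=; rewrite eqxx.
have rq : rmul (Lq m) (phi (g (Lq m, Ld m))) =
    snoc (Lq m) (phi n) + snoc (LV m) (phi (h * L (Lq m))).
  rewrite gqE !linearD /= rmul_reduced // phiM rmul_rmul //=.
  rewrite (bigD1 (LV m)) //= scale1r big1 ?addr0 => [|y yV]; last first.
    by case: y yV => [||||||| i] //= _; rewrite scale0r.
  rewrite [rmul (LV m) _]rmul_reduced ?phiM // => e.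
  by case: e => [||||||| i].
have n0 : n = 0.
  apply: phi_inj; rewrite linear0.
  have := gd (Lq m) (fun p x b s => sd p x (Lq m) b s isT).
  by rewrite rq linearD /= !strip_snoc eqxx /= !addr0.
exists h => -[p x] /= b; rewrite /syzygy.
case: eqP => [->|/eqP nqd]; first by rewrite gqE n0 add0r.
case: eqP => [->|/eqP nVd].
  have := gd (LV m) (fun p x b s => sd p x (LV m) b s isT).
  rewrite rq linearD /= !strip_snoc eqxx /= add0r -linearD => E.
  apply/eqP; rewrite mulrN -addr_eq0 addrC; apply/eqP/phi_inj.
  by rewrite linear0.
rewrite mulr0; apply: free => //.
  by apply: contra nqd => /eqP E; move: b; rewrite E; case: x {nVd}.
by apply: contra nVd => /eqP E; move: b; rewrite E; case: x {nqd}.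
Qed.

Lemma syzygy_relation z :
  \sum_(b | forbidden b.1 b.2) syzygy b * relation_coef b.1 b.2 z = 0.
Proof.
rewrite (bigD1 (Lq m, Ld m)) //= (bigD1 (LV m, Ld m)) //= big1 ?addr0; last first.
  by move=> b /andP[/andP[_ /negPf n1] /negPf n2]; rewrite /syzygy n1 n2 mul0r.
have qd0 : L (Lq m) * L (Ld m) = 0.
  by rewrite relA // big1 // => y _; rewrite scale0r.
have Uq : L (LU m) * L (Lq m) = L (Lq m) * L (LV m).
  rewrite relA // (bigD1 (LV m)) //= scale1r big1 ?addr0 // => y.
  by case: y => [||||||| i] //= _; rewrite scale0r.
rewrite /syzygy eqxx /relation_coef /= scale0r subr0 mulNr mulrBr.
rewrite -scalerAr qd0 scaler0 subr0.
by case: ifP => _; rewrite ?mulr0 ?subr0 // Uq subrr.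
Qed.

Lemma syzygy_free u : u * syzygy (Lq m, Ld m) = 0 -> u = 0.
Proof.
move=> u0; apply: phi_inj; rewrite linear0.
have /(congr1 (strip (LU m) \o phi)) /= := u0.
rewrite /syzygy eqxx phiM linear0 linear0 rmul_reduced ?strip_snoc ?eqxx // => e.
by case: e => [||||||| i].
Qed.

(** * The resolution and the Hilbert series *)
Variable gr : nat -> A -> Prop.
Hypothesis grP : forall n a, gr n a <->
  exists2 z : W, supported (fun w : seq (letter m) => size w = n) z & a = eval z.

Lemma gr0 n : gr n 0.
Proof. by apply/grP; exists 0; [exact: supported0 | rewrite linear0]. Qed.

Lemma grD n a b : gr n a -> gr n b -> gr n (a + b).
Proof.
move=> /grP[z sz ->] /grP[z' sz' ->]; apply/grP; exists (z + z').
  exact: supportedD.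
by rewrite linearD.
Qed.

Lemma grZ n c a : gr n a -> gr n (c *: a).
Proof.
move=> /grP[z sz ->]; apply/grP; exists (c *: z); first exact: supportedZ.
by rewrite linearZ.
Qed.

Lemma gr_evalU w : gr (size w) (eval << w >>).
Proof. by apply/grP; exists << w >> => //; exact: supportedU. Qed.

Lemma gr_letter x : gr 1 (L x).
Proof. by have := gr_evalU [:: x]; rewrite eval_cons eval_nil mul1r. Qed.

(** Two graded decompositions are padded by zeros to a common length. *)
Lemma positive_partD a b :
  positive_part gr a -> positive_part gr b -> positive_part gr (a + b).
Proof.
have pad k k' (x : 'I_k -> A) : (forall i : 'I_k, gr i.+1 (x i)) ->
    exists2 y : 'I_(k + k') -> A, (forall i : 'I_(k + k'), gr i.+1 (y i)) &
      \sum_i x i = \sum_i y i.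
  move=> gx; exists (fun i => match split i with inl j => x j | inr _ => 0 end).
    by move=> i; case: splitP => [j -> //|j _]; exact: gr0.
  rewrite big_split_ord /= [X in _ = _ + X]big1 ?addr0; last first.
    by move=> i _; case: splitP => // j /= E; have := ltn_ord j; lia.
  apply: eq_bigr => i _; case: splitP => [j /= E|j /= E].
    by congr x; apply: val_inj.
  by have := ltn_ord i; lia.
move=> [k [x [gx ->]]] [k' [x' [gx' ->]]].
have [y gy ->] := pad _ k' _ gx; have [y' gy' ->] := pad _ k _ gx'.
exists (k + k')%N, (fun i => y i + y' (cast_ord (addnC _ _) i)); split.
  by move=> i; apply: grD => //; exact: (gy' (cast_ord (addnC _ _) i)).
rewrite big_split /=; congr (_ + _).
rewrite (reindex (cast_ord (addnC k k'))) //=.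
by exists (cast_ord (addnC k' k)) => i _; apply: val_inj.
Qed.

Lemma positive_part_gr n a : gr n.+1 a -> positive_part gr a.
Proof.
move=> ga; exists n.+1, (fun i : 'I_n.+1 => if i == n :> nat then a else 0).
split=> [i|]; first by case: eqP => [->//|_]; exact: gr0.
by rewrite (bigD1 ord_max) //= eqxx big1 ?addr0 // => i; rewrite -val_eqE => /negPf ->.
Qed.

Lemma positive_partE a :
  positive_part gr a <-> exists u : letter m -> A, a = \sum_x u x * L x.
Proof.
split.
  move=> [k [x [gx ->]]]; elim/big_ind: _ => //.
  - by exists (fun=> 0); rewrite big1 // => y _; rewrite mul0r.
  - move=> _ _ [u ->] [v ->]; exists (fun y => u y + v y).
    by rewrite -big_split; apply: eq_bigr => y _; rewrite mulrDl.
  move=> i _; have /grP[z sz ->] := gx i.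
  exists (fun y => eval (strip y z)); rewrite {1}[z]word_decompose.
  have -> : z@_[::] = 0 by apply/eqP; apply: contraTT isT => /sz.
  rewrite scale0r add0r linear_sum; apply: eq_bigr => y _; exact: eval_snoc.
move=> [u ->]; elim/big_ind: _ => [||x _].
- by exists 0%N, (fun=> 0); split=> [[]//|]; rewrite big_ord0.
- exact: positive_partD.
rewrite -[u x]phiK -eval_snoc [phi _]malg_sumE !linear_sum /=.
elim/big_ind: _ => [||k _].
- by exists 0%N, (fun=> 0); split=> [[]//|]; rewrite big_ord0.
- exact: positive_partD.
rewrite !linearZ /= snocU; apply: (@positive_part_gr (size k)).
exact/grZ/(gr_evalU (x :: k)).
Qed.

(** The relations are indexed by their left-hand sides. *)
Definition bad_pair : pred (letter m * letter m) := fun b => forbidden b.1 b.2.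

Lemma bad_pair_Uq : (LU m, Lq m) \in bad_pair. Proof. by []. Qed.

Definition resolution_rank (i : nat) : nat :=
  match i with 0 => #|{: letter m}| | 1 => #|bad_pair| | 2 => 1 | _ => 0 end%N.

Definition resolution_d0 : 'M[A]_(#|{: letter m}|, 1) := \matrix_(i, j) L (enum_val i).
Definition resolution_d1 : 'M[A]_(#|bad_pair|, #|{: letter m}|) :=
  \matrix_(i, j) relation_coef (enum_val i).1 (enum_val i).2 (enum_val j).
Definition resolution_d2 : 'M[A]_(1, #|bad_pair|) := \matrix_(i, j) syzygy (enum_val j).

Definition resolution_d (i : nat) :
    'M[A]_(res_rank resolution_rank i.+1, res_rank resolution_rank i) :=
  match i return 'M[A]_(res_rank resolution_rank i.+1, res_rank resolution_rank i) with
  | 0%N => resolution_d0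
  | 1%N => resolution_d1
  | 2%N => resolution_d2
  | _ => 0
  end.

Lemma mul_resolution_d0 (u : 'rV[A]_#|{: letter m}|) :
  (u *m resolution_d0) 0 0 = \sum_x u 0 (enum_rank x) * L x.
Proof.
rewrite mxE (reindex (@enum_rank (letter m))) /=; last exact/onW_bij/enum_rank_bij.
by apply: eq_bigr => x _; rewrite mxE enum_rankK.
Qed.

Lemma mul_resolution_d1 (u : 'rV[A]_#|bad_pair|) j : (u *m resolution_d1) 0 j =
  \sum_(b | forbidden b.1 b.2)
    u 0 (enum_rank_in bad_pair_Uq b) * relation_coef b.1 b.2 (enum_val j).
Proof.
rewrite mxE (big_enum_rank bad_pair_Uq); apply: eq_bigr => b bb.
by rewrite mxE enum_rankK_in.
Qed.

Lemma mul_resolution_d1_row (g : letter m * letter m -> A) j :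
  ((\row_i g (enum_val i)) *m resolution_d1) 0 j =
  \sum_(b | forbidden b.1 b.2) g b * relation_coef b.1 b.2 (enum_val j).
Proof.
rewrite mxE [RHS](big_enum_val (A := bad_pair)); apply: eq_bigr => b _.
by rewrite !mxE.
Qed.

Lemma model_koszul : koszul gr.
Proof.
exists resolution_rank, resolution_d; split.
- case=> [|[|[|i]]] j k /=; rewrite mxE.
  + exact: gr_letter.
  + rewrite /relation_coef; apply: grD.
      by case: ifP => _; [exact: gr_letter | exact: gr0].
    by rewrite -scaleNr; apply/grZ/gr_letter.
  + rewrite /syzygy; case: ifP => _; first exact: gr_letter.
    case: ifP => _; last exact: gr0.
    by rewrite -scaleN1r; apply/grZ/gr_letter.
  + exact: gr0.
- move=> a; rewrite positive_partE; split=> [[u ->]|[u <-]].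
    exists (\row_i u (enum_val i)); rewrite mul_resolution_d0.
    by apply: eq_bigr => x _; rewrite mxE enum_rankK.
  by exists (fun x => u 0 (enum_rank x)); rewrite mul_resolution_d0.
case=> [|[|[|i]]] v /=.
- split=> [v0|[u <-]].
    have [|g gE] := @exact_relations (fun x => v 0 (enum_rank x)).
      by rewrite -mul_resolution_d0 v0 mxE.
    exists (\row_i g (enum_val i)); apply/rowP => j.
    by rewrite mul_resolution_d1_row -gE enum_valK.
  apply/rowP => j; rewrite ord1 mul_resolution_d0 mxE.
  rewrite (eq_bigr (fun x => \sum_(b | forbidden b.1 b.2)
     u 0 (enum_rank_in bad_pair_Uq b) * (relation_coef b.1 b.2 x * L x))); last first.
    move=> x _; rewrite mul_resolution_d1 mulr_suml; apply: eq_bigr => b _.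
    by rewrite enum_rankK mulrA.
  rewrite exchange_big big1 //= => b bb.
  by rewrite -mulr_sumr relation_coefP ?mulr0.
- split=> [v0|[u <-]].
    have [|u uE] := @exact_syzygies (fun b => v 0 (enum_rank_in bad_pair_Uq b)).
      by move=> z; rewrite -[z]enum_rankK -mul_resolution_d1 v0 mxE.
    exists (u%:M); apply/rowP => j; rewrite mul_scalar_mx !mxE -uE ?enum_valK_in //.
    exact: (enum_valP j).
  apply/rowP => j; rewrite mul_resolution_d1 mxE.
  rewrite (eq_bigr (fun b => u 0 0 * (syzygy b * relation_coef b.1 b.2 (enum_val j)))).
    by rewrite -mulr_sumr syzygy_relation mulr0.
  by move=> b bb; rewrite !mxE big_ord1 mxE enum_rankK_in // mulrA.
- split=> [v0|[u <-]].
    exists 0; rewrite mul0mx; apply/esym/rowP => j; rewrite ord1 mxE.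
    apply: syzygy_free.
    have /matrixP/(_ 0 (enum_rank_in bad_pair_Uq (Lq m, Ld m))) := v0.
    by rewrite !mxE big_ord1 mxE enum_rankK_in.
  by rewrite mulmx0 mul0mx.
- split=> [_|_]; last by rewrite mulmx0.
  by exists 0; apply/rowP => -[].
Qed.

(** Normal words are their own normal forms; hence they are independent in A. *)
Lemma phi_normal n w : w \in normal_words m n -> phi (eval << w >>) = << w >>.
Proof.
elim: w n => [|x w IH] [|n]; first by rewrite eval_nil phi1.
- by rewrite normal_words_nil.
- by move/normal_words_size => E; discriminate E.
rewrite normal_words_cons eval_cons phiM => /andP[nw aw].
rewrite (IH _ nw) rmulU; exact: rword_appendable.
Qed.

Lemma phi_supported n z : supported (fun w : seq (letter m) => size w = n) z ->
  supported (fun w => w \in normal_words m n) (phi (eval z)).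
Proof.
move=> sz; rewrite eval_sumE linear_sum big_seq; apply: supported_sum => w.
rewrite -mcoeff_neq0 => zw; rewrite linearZ; apply: supportedZ.
have /= <- := sz w zw.
elim: w {zw} => [|x w IH]; first by rewrite eval_nil phi1; exact: supportedU.
rewrite eval_cons phiM /rmul locked_withE.
apply: supported_linext IH => k nk k' /(rword_normal nk).
by case.
Qed.

Lemma gr_has_dim n : has_dim (gr n) (size (normal_words m n)).
Proof.
exists (fun i => eval << nth [::] (normal_words m n) i >>); split.
- move=> i; have := gr_evalU (nth [::] (normal_words m n) i).
  by rewrite (normal_words_size (mem_nth [::] (ltn_ord i))).
- move=> v /grP[z sz ->].
  exists (fun i => (phi (eval z))@_(nth [::] (normal_words m n) i)).
  rewrite -[LHS]phiK {1}(supported_expand (normal_words_uniq m n) (phi_supported sz)).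
  rewrite (big_nth [::]) big_mkord linear_sum; apply: eq_bigr => i _.
  by rewrite linearZ.
move=> c /(congr1 phi); rewrite linear0 linear_sum => c0 i.
have /(congr1 (mcoeff (nth [::] (normal_words m n) i))) := c0.
rewrite mcoeff0 raddf_sum (bigD1 i) //= linearZ /=.
rewrite (phi_normal (mem_nth [::] (ltn_ord i))) mcoeffZ mcoeffUU mulr1.
rewrite big1 ?addr0 // => j ji; rewrite linearZ /=.
rewrite (phi_normal (mem_nth [::] (ltn_ord j))) mcoeffZ mcoeffU.
by rewrite nth_uniq ?normal_words_uniq // val_eqE (negPf ji) mulr0.
Qed.

Lemma model_hilbert : hilbert_series_inv_of gr
  (1 - (m + 9)%:R *: 'X + (m + 9)%:R *: 'X^2 - 'X^3).
Proof.
exists (fun n => size (normal_words m n)); split; first exact: gr_has_dim.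
by apply: inverse_of_recurrence;
  [|exact: count_normal1|exact: count_normal2|exact: count_normalSSS].
Qed.

End Model.

(** * Products of two linear factors over a noncommutative ring *)
Section QuadraticPolynomials.
Variable R : nzRingType.
Implicit Types a b c d : R.

Lemma quad_polyE a b :
  ('X - a%:P) * ('X - b%:P) = 'X^2 - (a + b)%:P * 'X + (a * b)%:P.
Proof.
rewrite mulrBl !mulrBr -expr2 -(commr_polyX b%:P) polyCD polyCM mulrDl.
rewrite opprB opprD !addrA [LHS]addrAC; congr (_ + _); exact: addrAC.
Qed.

Lemma coef_quad a b c d i :
  (('X - a%:P) * ('X - b%:P) - ('X - c%:P) * ('X - d%:P))`_i =
  match i with 0%N => a * b - c * d | 1%N => (c + d) - (a + b) | _ => 0 end.
Proof.
rewrite !quad_polyE !(coefB, coefD, coefXn, coefMX, coefCM, coefX, coefC).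
case: i => [|[|i]] /=; rewrite ?mulr0 ?mulr1 ?subrr ?sub0r ?add0r ?addr0 ?subr0 //.
by rewrite opprK addrC.
Qed.

End QuadraticPolynomials.

(** * The layered graph *)
Section Graph.
Variable m : nat.

(** Top is the vertex of layer 3, Star the minimal one; the vertices V* form
    layer 2 and the vertices W* layer 1. *)
Inductive vtx := Top | VQ | VV | VT | W1 | W2 | W3 | Star | VS of 'I_m.+2.

Definition vtx_code (v : vtx) : 'I_8 + 'I_m.+2 :=
  match v with
  | Top => inl (@Ordinal 8 0 isT) | VQ => inl (@Ordinal 8 1 isT)
  | VV => inl (@Ordinal 8 2 isT) | VT => inl (@Ordinal 8 3 isT)
  | W1 => inl (@Ordinal 8 4 isT) | W2 => inl (@Ordinal 8 5 isT)
  | W3 => inl (@Ordinal 8 6 isT) | Star => inl (@Ordinal 8 7 isT)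
  | VS i => inr i
  end.

Definition vtx_decode (u : 'I_8 + 'I_m.+2) : vtx :=
  match u with
  | inl j => nth Top [:: Top; VQ; VV; VT; W1; W2; W3; Star] j
  | inr i => VS i
  end.

Lemma vtx_codeK : cancel vtx_code vtx_decode.
Proof. by case. Qed.

HB.instance Definition _ := Finite.copy vtx (can_type vtx_codeK).

Definition arrow (v w : vtx) : bool :=
  match v, w with
  | Top, (VQ | VV)
  | (VQ | VV | VS _), (W1 | W2)
  | VT, (W1 | W2 | W3)
  | (W1 | W2 | W3), Star => true
  | VS i, W3 => (i < 2)%N
  | _, _ => false
  end.

Definition vlevel (v : vtx) : 'I_4 :=
  match v with
  | Top => @Ordinal 4 3 isT
  | VQ | VV | VT | VS _ => @Ordinal 4 2 isT
  | W1 | W2 | W3 => @Ordinal 4 1 isT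
  | Star => @Ordinal 4 0 isT
  end.

Definition arrow_type : finType := {p : vtx * vtx | arrow p.1 p.2}.
Definition atail (e : arrow_type) : vtx := (val e).1.
Definition ahead (e : arrow_type) : vtx := (val e).2.

Lemma arrow_level v w : arrow v w -> vlevel v = (vlevel w).+1 :> nat.
Proof. by case: v => [||||||||i]; case: w. Qed.

Lemma level_arrow e : vlevel (atail e) = (vlevel (ahead e)).+1 :> nat.
Proof. exact: arrow_level (valP e). Qed.

Definition graph : layered_graph 3 := LayeredGraph level_arrow.

Definition mk_edge v w (vw : arrow v w) : edge graph :=
  Sub (v, w) (vw : arrow (v, w).1 (v, w).2).

Section Labels.
Variables (M : zmodType) (l : letter m -> M).
Local Notation U := (l (LU m)).
Local Notation q := (l (Lq m)).
Local Notation V := (l (LV m)).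
Local Notation T := (l (LT m)).
Local Notation a := (l (La m)).
Local Notation d := (l (Ld m)).
Local Notation c := (l (Lc m)).
Local Notation S i := (l (LS i)).

(** The sum x_v of the edges along a path from v to the minimal vertex, in terms
    of the letters. *)
Definition vval (v : vtx) : M :=
  match v with
  | Star => 0
  | W1 => a | W2 => a - d | W3 => a - c
  | VV => V + a | VQ => V + q + a | VT => T + a | VS i => T + S i + a
  | Top => U + (V + q + a)
  end.

(** The edge from v to w in terms of the letters, that is x_v - x_w with the
    common terms cancelled. *)
Definition label (v w : vtx) : M :=
  match v, w with
  | Top, VQ => U | Top, VV => U + q
  | VQ, W1 => V + q | VQ, W2 => V + q + d
  | VV, W1 => V | VV, W2 => V + d
  | VT, W1 => T | VT, W2 => T + d | VT, W3 => T + c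
  | VS i, W1 => T + S i | VS i, W2 => T + S i + d | VS i, W3 => T + S i + c
  | W1, Star => a | W2, Star => a - d | W3, Star => a - c
  | _, _ => 0
  end.

Lemma labelE v w : arrow v w -> label v w = vval v - vval w.
Proof.
have add_sub x y z : x + y = (x + z) - (z - y) :> M.
  by rewrite opprB addrA [RHS]addrAC addrK.
case: v => [||||||||i]; case: w => //= _; rewrite ?subr0 ?addrK ?add_sub //.
by rewrite -addrA [V + q]addrC -[q + V + a]addrA addrK.
Qed.

End Labels.

Section LetterLabel.
Variables (M : zmodType) (g : vtx -> vtx -> M).

(** Conversely, each letter is an edge or a difference of two edges. *)
Definition letter_label (x : letter m) : M :=
  match x with
  | LU => g Top VQ
  | LV => g VV W1
  | Lq => g VQ W1 - g VV W1
  | LT => g VT W1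
  | LS i => g (VS i) W1 - g VT W1
  | La => g W1 Star
  | Ld => g W1 Star - g W2 Star
  | Lc => g W1 Star - g W3 Star
  end.

(** Only the linear relations between paths of two edges are used. *)
Lemma label_letter_label :
  (forall v0 v1 v1' v2, arrow v0 v1 -> arrow v1 v2 -> arrow v0 v1' -> arrow v1' v2 ->
    g v0 v1 + g v1 v2 = g v0 v1' + g v1' v2) ->
  forall v w, arrow v w -> label letter_label v w = g v w.
Proof.
move=> gE.
have sw v0 v1 v1' v2 : arrow v0 v1 -> arrow v1 v2 -> arrow v0 v1' -> arrow v1' v2 ->
    g v0 v1 + (g v1 v2 - g v1' v2) = g v0 v1'.
  by move=> h1 h2 h3 h4; rewrite addrA (gE _ _ v1') // addrK.
case=> [||||||||i]; case=> // h; rewrite /label /letter_label ?subrKC //.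
all: try exact: sw.
all: try by rewrite opprB subrKC.
Qed.

End LetterLabel.

Lemma letter_label_label (M : zmodType) (l : letter m -> M) x :
  letter_label (label l) x = l x.
Proof.
case: x => [||||||| i] //=; rewrite ?opprB ?subrKC //.
all: try by rewrite addrAC subrr add0r.
Qed.

Lemma label_morph (M N : zmodType) (f : {additive M -> N}) (l : letter m -> M) v w :
  f (label l v w) = label (f \o l) v w.
Proof. by case: v => [||||||||i]; case: w => //=; rewrite ?raddf0 ?raddfB ?raddfD. Qed.

Lemma label_closed (M : zmodType) (P : M -> Prop) (l : letter m -> M) v w :
  P 0 -> (forall x y, P x -> P y -> P (x + y)) -> (forall x, P x -> P (- x)) ->
  (forall p, P (l p)) -> P (label l v w).
Proof. by move=> P0 PD PN Pl; case: v => [||||||||i]; case: w => /=; auto. Qed.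

Lemma labelD (M : zmodType) (l l' : letter m -> M) v w :
  label (fun y => l y + l' y) v w = label l v w + label l' v w.
Proof.
case: v => [||||||||i]; case: w => //=; rewrite ?addr0 // ?opprD.
all: by rewrite [RHS]addrACA 1?[X in _ = X + _]addrACA.
Qed.

Lemma letter_label_morph (M N : zmodType) (f : {additive M -> N})
    (g : vtx -> vtx -> M) x :
  f (letter_label g x) = letter_label (fun v w => f (g v w)) x.
Proof. by case: x => [||||||| i] //=; rewrite ?raddfB. Qed.

Lemma eq_label (M : zmodType) (l l' : letter m -> M) v w :
  l =1 l' -> label l v w = label l' v w.
Proof. by move=> ll; case: v => [||||||||i]; case: w => //=; rewrite !ll. Qed.

Lemma sum_sigma (F : fieldType) (M : lmodType F) (f : letter m -> M) p x :
  \sum_y sigma F p x y *: f y =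
  match p, x with
  | LU, Lq => f (LV m)
  | (LV | LT), Ld => f (La m) - f (Ld m)
  | LT, Lc => f (La m) - f (Lc m)
  | _, _ => 0
  end.
Proof.
rewrite big_letter; case: p => [||||||| i]; case: x => [||||||| j] /=;
  rewrite ?scale0r ?scale1r ?scaleN1r ?add0r big1 ?addr0 // => k _;
  by rewrite scale0r.
Qed.

End Graph.

(** Operators that satisfy the relations between letters also satisfy the
    relations between paths of two edges: a path to the minimal vertex can be
    compared with the one through W1, and from Top there are only the two
    middle vertices VQ and VV. *)
Lemma label_act_quad (m : nat) (M : zmodType)
    (r : letter m -> {additive M -> M}) (z : M) :
  r (Lq m) (r (LU m) z) = r (LV m) (r (Lq m) z) ->
  r (Ld m) (r (Lq m) z) = 0 ->
  r (Ld m) (r (LV m) z) = r (La m) (r (Ld m) z) - r (Ld m) (r (Ld m) z) ->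
  r (Ld m) (r (LT m) z) = r (La m) (r (Ld m) z) - r (Ld m) (r (Ld m) z) ->
  r (Lc m) (r (LT m) z) = r (La m) (r (Lc m) z) - r (Lc m) (r (Lc m) z) ->
  (forall i, r (Ld m) (r (LS i) z) = 0) ->
  (forall i : 'I_m.+2, (i < 2)%N -> r (Lc m) (r (LS i) z) = 0) ->
  forall v0 v1 v1' v2,
    arrow v0 v1 -> arrow v1 v2 -> arrow v0 v1' -> arrow v1' v2 ->
  label (fun p => r p (label (fun p => r p z) v0 v1)) v1 v2 =
  label (fun p => r p (label (fun p => r p z) v0 v1')) v1' v2.
Proof.
move=> Uq qd Vd Td Tc Sd Sc.
have tele (x y t : M) : x + y + (- (y - t) - t) = x.
  by rewrite opprB [X in _ + X]addrAC subrr sub0r addrK.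
pose via_W1 v := r (La m) (label (fun p => r p z) v (W1 m)).
have star v w : arrow v w -> arrow w (Star m) ->
    label (fun p => r p (label (fun p => r p z) v w)) w (Star m) = via_W1 v.
  rewrite /via_W1.
  case: v => [||||||||i]; case: w => //=; rewrite ?raddfD /= ?Vd ?Td ?Tc ?qd ?Sd //;
    move=> h _; rewrite ?Sc // ?subr0 ?opprD ?oppr0 ?addr0 ?add0r //;
    by rewrite opprK !addrK.
have top w : arrow (VQ m) w -> arrow (VV m) w ->
    label (fun p => r p (label (fun p => r p z) (Top m) (VQ m))) (VQ m) w =
    label (fun p => r p (label (fun p => r p z) (Top m) (VV m))) (VV m) w.
  by case: w => //= _ _; rewrite !raddfD /= Uq ?qd ?addr0.
move=> v0 v1 v1' v2 a01 a12 a01' a12'.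
have [E|nS] := eqVneq v2 (Star m); first by subst v2; rewrite !star.
have E : v0 = Top m.
  by case: v0 v1 a01 a12 nS {a01'} => [||||||||i] [||||||||j] //; case: v2 {a12'}.
by subst v0; case: v1 a01 a12 => // _ a12;
  case: v1' a01' a12' => // _ a12'; rewrite top.
Qed.

(** * The action of the graph algebra on words *)
Section Action.
Variables (m : nat) (F : fieldType).
Local Notation G := (graph m).
Local Notation W := {malg F[seq (letter m)]}.
Local Notation free := (free_alg F G).
Local Notation A := (graph_alg F G).
Implicit Types (z : W) (x y : free) (e f : edge G).

Definition edge_op (e : edge G) (z : W) : W :=
  label (fun p => rmul p z) (atail e) (ahead e).

Lemma edge_op_is_linear e : linear (edge_op e).
Proof.
move=> c u v; rewrite /edge_op -[c *: _]/(( *:%R c) _) label_morph -labelD.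
by apply: eq_label => p; rewrite linearP.
Qed.

HB.instance Definition _ e := GRing.isLinear.Build F W W _ (edge_op e)
  (edge_op_is_linear e).

Definition word_op (k : {fmonom (edge G)}) (z : W) : W :=
  foldl (fun z e => edge_op e z) z k.

Lemma word_op_is_linear k : linear (word_op k).
Proof.
case: k => s c; rewrite /word_op /=; elim: s => //= e s IH u v.
by rewrite linearP IH.
Qed.

HB.instance Definition _ k := GRing.isLinear.Build F W W _ (word_op k)
  (word_op_is_linear k).

Fact act_key : unit. Proof. by []. Qed.
Definition act z : free -> W := locked_with act_key (linext (fun k => word_op k z)).

Lemma act_is_linear z : linear (act z).
Proof. by rewrite /act locked_withE; exact: linext_is_linear. Qed.

HB.instance Definition _ z := GRing.isLinear.Build F free W _ (act z)
  (act_is_linear z).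

Lemma actU z k : act z << k >> = word_op k z.
Proof. by rewrite /act locked_withE linextU. Qed.

Lemma actE z x : act z x = \sum_(k <- msupp x) x@_k *: word_op k z.
Proof. by rewrite /act locked_withE. Qed.

Lemma actD z x y : act z (x + y) = act z x + act z y.
Proof. exact: linearD. Qed.

Lemma actB z x y : act z (x - y) = act z x - act z y.
Proof. exact: linearB. Qed.

Lemma act_linear_l x : linear (act^~ x).
Proof.
move=> c u v; rewrite !actE scaler_sumr -big_split; apply: eq_bigr => k _.
by rewrite linearP scalerDr !scalerA mulrC.
Qed.

Lemma act0 x : act 0 x = 0.
Proof. by rewrite actE big1 // => k _; rewrite linear0 scaler0. Qed.

Lemma malgUM (k k' : {fmonom (edge G)}) :
  << k >> * << k' >> = << mmul k k' >> :> free.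
Proof. by rewrite malgM_def fgmulUU mulr1. Qed.

Lemma actM z x y : act z (x * y) = act (act z x) y.
Proof.
move: x; apply: eq_on_basis => [c u v|c u v|k].
- by rewrite mulrDl -scalerAl linearP.
- by rewrite linearP; exact: act_linear_l.
move: y; apply: eq_on_basis => [c u v|c u v|k'].
- by rewrite mulrDr -malg_scalerAr linearP.
- by rewrite linearP.
by rewrite malgUM !actU /word_op fmM foldl_cat.
Qed.

Lemma act_gen z e : act z (gen F e) = edge_op e z.
Proof. by rewrite actU. Qed.

Lemma act1 z : act z 1 = z.
Proof. by rewrite actU /word_op fm1. Qed.

(** The elements that act by zero; they form a two-sided ideal. *)
Definition kills x := forall z, act z x = 0.

Lemma kills0 : kills 0. Proof. by move=> z; rewrite linear0. Qed.

Lemma killsD x y : kills x -> kills y -> kills (x + y).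
Proof. by move=> kx ky z; rewrite linearD /= kx ky addr0. Qed.

Lemma killsMl x y : kills y -> kills (x * y).
Proof. by move=> ky z; rewrite actM. Qed.

Lemma killsMr x y : kills x -> kills (x * y).
Proof. by move=> kx z; rewrite actM kx act0. Qed.

Definition kills_poly (P : {poly free}) := forall i, kills P`_i.

Lemma kills_sum (I : Type) (s : seq I) (f : I -> free) :
  (forall i, kills (f i)) -> kills (\sum_(i <- s) f i).
Proof. by move=> kf; elim/big_ind: _ => //; [exact: kills0|exact: killsD]. Qed.

Lemma kills_polyD P Q : kills_poly P -> kills_poly Q -> kills_poly (P + Q).
Proof. by move=> kP kQ i; rewrite coefD; apply: killsD. Qed.

Lemma kills_polyMl P Q : kills_poly Q -> kills_poly (P * Q).
Proof. by move=> kQ i; rewrite coefM; apply: kills_sum => j; apply: killsMl. Qed.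

Lemma kills_polyMr P Q : kills_poly P -> kills_poly (P * Q).
Proof. by move=> kP i; rewrite coefM; apply: kills_sum => j; apply: killsMr. Qed.

Lemma edge_opE e z : edge_op e z =
  vval (fun p => rmul p z) (atail e) - vval (fun p => rmul p z) (ahead e).
Proof. exact: labelE (valP e). Qed.

Lemma edge_op_quad z e1 e2 f1 f2 :
    ahead e1 = atail e2 -> ahead f1 = atail f2 ->
    atail e1 = atail f1 -> ahead e2 = ahead f2 ->
  edge_op e2 (edge_op e1 z) = edge_op f2 (edge_op f1 z).
Proof.
move=> he hf ht hh; rewrite /edge_op.
have rel (p s : letter m) (u : W) (b : forbidden p s) :=
  etrans (rmul_rmul u b) (sum_sigma (fun t => rmul t (rmul s u)) p s).
have a1 : arrow (atail e1) (ahead e1) := valP e1.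
have a2 : arrow (atail e2) (ahead e2) := valP e2.
have b1 : arrow (atail f1) (ahead f1) := valP f1.
have b2 : arrow (atail f2) (ahead f2) := valP f2.
rewrite -he -hf -ht -hh in a2 b1 b2 *.
apply: (@label_act_quad m W (fun p => rmul p : {additive W -> W})) => //.
- exact: (rel (LU m) (Lq m)).
- exact: (rel (Lq m) (Ld m)).
- exact: (rel (LV m) (Ld m)).
- exact: (rel (LT m) (Ld m)).
- exact: (rel (LT m) (Lc m)).
- by move=> i; exact: (rel (LS i) (Ld m)).
- by move=> i; exact: (rel (LS i) (Lc m)).
Qed.

Lemma kills_quad0 e1 e2 f1 f2 :
    ahead e1 = atail e2 -> ahead f1 = atail f2 ->
    atail e1 = atail f1 -> ahead e2 = ahead f2 ->
  kills (gen F e1 * gen F e2 - gen F f1 * gen F f2).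
Proof.
move=> he hf ht hh z.
have := edge_op_quad z he hf ht hh; rewrite -!act_gen.
move: (gen F e1) (gen F e2) (gen F f1) (gen F f2) => x1 x2 y1 y2 E.
rewrite actB; apply/eqP; rewrite subr_eq0; apply/eqP.
exact: etrans (actM z x1 x2) (etrans E (esym (actM z y1 y2))).
Qed.

Lemma kills_quad1 e1 e2 f1 f2 :
    ahead e1 = atail e2 -> ahead f1 = atail f2 ->
    atail e1 = atail f1 -> ahead e2 = ahead f2 ->
  kills ((gen F f1 + gen F f2) - (gen F e1 + gen F e2)).
Proof.
move=> he hf ht hh z.
have : edge_op f1 z + edge_op f2 z = edge_op e1 z + edge_op e2 z.
  by rewrite !edge_opE he hf ht hh !addrA !subrK.
rewrite -!act_gen.
move: (gen F e1) (gen F e2) (gen F f1) (gen F f2) => x1 x2 y1 y2 E.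
rewrite actB (actD z x1) (actD z y1) E; exact: subrr.
Qed.

Lemma kills_quad e1 e2 f1 f2 :
    ahead e1 = atail e2 -> ahead f1 = atail f2 ->
    atail e1 = atail f1 -> ahead e2 = ahead f2 ->
  kills_poly (('X - (gen F e1)%:P) * ('X - (gen F e2)%:P) -
              ('X - (gen F f1)%:P) * ('X - (gen F f2)%:P)).
Proof.
move=> he hf ht hh i; rewrite coef_quad; case: i => [|[|i]].
- exact: kills_quad0.
- exact: kills_quad1.
- exact: kills0.
Qed.

(** Two paths of three edges are compared through the path that takes the first
    edge of one and the last edge of the other; P is the factor of its middle
    edge. *)
Lemma kills_poly_switch (E1 E2 E3 F1 F2 F3 P : {poly free}) :
  kills_poly (E1 * E2 - F1 * P) -> kills_poly (P * E3 - F2 * F3) ->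
  kills_poly (E1 * (E2 * E3) - F1 * (F2 * F3)).
Proof.
move=> k1 k2.
have -> : E1 * (E2 * E3) - F1 * (F2 * F3) =
    (E1 * E2 - F1 * P) * E3 + F1 * (P * E3 - F2 * F3).
  by rewrite mulrBl mulrBr !mulrA addrA subrK.
by apply: kills_polyD; [apply: kills_polyMr|apply: kills_polyMl].
Qed.

Lemma path_poly2 e1 e2 : path_poly F [:: e1; e2] =
  ('X - (gen F e1)%:P) * ('X - (gen F e2)%:P).
Proof. by rewrite /path_poly big_cons big_seq1. Qed.

Lemma path_poly3 e1 e2 e3 : path_poly F [:: e1; e2; e3] =
  ('X - (gen F e1)%:P) * (('X - (gen F e2)%:P) * ('X - (gen F e3)%:P)).
Proof. by rewrite /path_poly big_cons -/(path_poly F _) path_poly2. Qed.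

Lemma edge_ext e f : atail e = atail f -> ahead e = ahead f -> e = f.
Proof.
move=> ht hh; apply: val_inj; move: ht hh; rewrite /atail /ahead.
by case: (val e) (val f) => [v w] [v' w'] /= -> ->.
Qed.

(** The relators of paths with one edge are trivial because there are no
    parallel edges, and there are no paths with four edges. *)
Lemma kills_relator x : relator x -> kills x.
Proof.
move=> [e [s [f [s' [[ds ds' ss ht hh] [i ->]]]]]]; move: i.
rewrite -/(kills_poly _).
case: s s' ds ds' ss hh => [|e2 [|e3 [|e4 s]]] [|f2 [|f3 [|f4 s']]] //; last first.
- rewrite /is_dipath => /= /and4P[/eqP h1 /eqP h2 /eqP h3 _].
  have := (level_arrow e, level_arrow e2, level_arrow e3, level_arrow e4).
  have := ltn_ord (vlevel (atail e)).
  move: h1 h2 h3; rewrite /ehead /etail /= => -> -> -> ? [[[? ?] ?] ?]; lia.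
- rewrite /is_dipath => /= /and3P[/eqP h1 /eqP h2 _] /and3P[/eqP k1 /eqP k2 _] _ hh.
  (* The first edges start at Top, and each of VQ and VV is joined to W1 and W2. *)
  have ag : arrow (ahead f) (ahead e2).
    have a1 : arrow (atail e) (ahead e) := valP e.
    have b1 : arrow (atail f) (ahead f) := valP f.
    have a2 : arrow (atail e2) (ahead e2) := valP e2.
    have a3 : arrow (atail e3) (ahead e3) := valP e3.
    have {}ht : atail e = atail f := ht.
    have {}h1 : ahead e = atail e2 := h1.
    have {}h2 : ahead e2 = atail e3 := h2.
    rewrite -ht -h1 -h2 in b1 a2 a3.
    move: (atail e) (ahead e) (ahead f) (ahead e2) (ahead e3) a1 b1 a2 a3 {h1 h2 ht}.
    move=> [||||||||i0] [||||||||i1] // [||||||||i2] //;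
      by move=> [||||||||i3] // [||||||||i4].
  rewrite !path_poly3.
  apply: (@kills_poly_switch _ _ _ _ _ _ ('X - (gen F (mk_edge ag))%:P));
    exact: kills_quad.
- rewrite /is_dipath => /= /andP[/eqP h _] /andP[/eqP k _] _ hh.
  by rewrite !path_poly2; apply: kills_quad.
move=> _ _ _ hh; rewrite (edge_ext ht hh) subrr => i; rewrite coef0; exact: kills0.
Qed.

Lemma kills_ideal x : in_ideal x -> kills x.
Proof.
elim=> [|u v w y rv _ IH]; first exact: kills0.
by apply: killsD => //; apply/killsMr/killsMl/kills_relator.
Qed.

End Action.

(** * Generators and relations of the graph algebra *)
Lemma eq_letter_label (m : nat) (M : zmodType) (g g' : vtx m -> vtx m -> M) p :
  (forall v w, arrow v w -> g v w = g' v w) -> letter_label g p = letter_label g' p.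
Proof. by move=> gg; case: p => [||||||| i] /=; rewrite !gg. Qed.

(** The quadratic relation between the paths v > W1 > * and v > Wj > *, whose
    first edges are x and x + d and whose second edges are a and a - d. *)
Lemma telescoped_swap (R : nzRingType) (x a d : R) :
  x * a = (x + d) * (a - d) -> x * d = d * a - d * d.
Proof.
rewrite mulrDl !mulrBr => E; apply/eqP; rewrite -subr_eq0; apply/eqP.
move/eqP: E; rewrite -addrA -subr_eq0 opprD addrA subrr sub0r opprD opprK.
by move/eqP.
Qed.

Lemma label_relations (m : nat) (F : fieldType) (B : algType F) (l : letter m -> B) :
  (forall v0 v1 v1' v2, arrow v0 v1 -> arrow v1 v2 -> arrow v0 v1' -> arrow v1' v2 ->
    label l v0 v1 * label l v1 v2 = label l v0 v1' * label l v1' v2) ->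
  forall p x, forbidden p x -> l p * l x = \sum_y sigma F p x y *: (l x * l y).
Proof.
move=> quad p x.
have d v : arrow v (W1 m) -> arrow v (W2 m) ->
    label l v (W2 m) = label l v (W1 m) + l (Ld m) ->
    label l v (W1 m) * l (Ld m) =
    l (Ld m) * l (La m) - l (Ld m) * l (Ld m).
  by move=> a1 a2 E; apply: telescoped_swap; rewrite -E;
    exact: (quad v (W1 m) (W2 m) (Star m)).
have c v : arrow v (W1 m) -> arrow v (W3 m) ->
    label l v (W3 m) = label l v (W1 m) + l (Lc m) ->
    label l v (W1 m) * l (Lc m) =
    l (Lc m) * l (La m) - l (Lc m) * l (Lc m).
  by move=> a1 a2 E; apply: telescoped_swap; rewrite -E;
    exact: (quad v (W1 m) (W3 m) (Star m)).
have Vd := d (VV m) isT isT erefl; have Td := d (VT m) isT isT erefl.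
have qd := d (VQ m) isT isT erefl; have Sd i := d (VS i) isT isT erefl.
have Tc := c (VT m) isT isT erefl.
have Sc (i : 'I_m.+2) (h : (i < 2)%N) := c (VS i) isT h erefl.
have Uq := quad (Top m) (VQ m) (VV m) (W1 m) isT isT isT isT.
rewrite /= in Vd Td qd Sd Tc Sc Uq.
rewrite sum_sigma; case: p => [||||||| i]; case: x => [||||||| j] //= h.
- by apply: (@addrI _ (l (LU m) * l (LV m))); rewrite -mulrDr Uq mulrDl.
- by apply: (@addrI _ (l (LV m) * l (Ld m))); rewrite -mulrDl qd Vd addr0.
- by apply: (@addrI _ (l (LT m) * l (Ld m))); rewrite -mulrDl Sd Td addr0.
- by apply: (@addrI _ (l (LT m) * l (Lc m))); rewrite -mulrDl Sc // Tc addr0.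
Qed.

(* The graph algebra enters through its projection from the free algebra only;
   A is abstract so that the quotient is never unfolded. *)
Section Presentation.
Variables (m : nat) (F : fieldType).
Local Notation G := (graph m).
Local Notation W := {malg F[seq (letter m)]}.
Local Notation free := (free_alg F G).
Variables (A : algType F) (proj : {lrmorphism free -> A}) (rep : A -> free).
Hypothesis projE : forall x y : free, proj x = proj y <-> in_ideal (x - y).
Hypothesis repK : cancel rep proj.

Lemma proj_eq (x y : free) : proj (x - y) = 0 -> proj x = proj y.
Proof. by rewrite raddfB => /eqP; rewrite subr_eq0 => /eqP. Qed.

(** Zero is a default value for the pairs of vertices that are not joined. *)
Definition arrow_class (v w : vtx m) : A :=
  if insub (v, w) is Some e then proj (gen F (e : edge G)) else 0.

Lemma arrow_classE (e : edge G) : arrow_class (atail e) (ahead e) = proj (gen F e).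
Proof.
rewrite /arrow_class /atail /ahead -surjective_pairing.
by have -> : insub (val e) = Some e by exact: valK.
Qed.

Lemma arrow_class_quad v0 v1 v1' v2 :
    arrow v0 v1 -> arrow v1 v2 -> arrow v0 v1' -> arrow v1' v2 ->
  arrow_class v0 v1 + arrow_class v1 v2 = arrow_class v0 v1' + arrow_class v1' v2 /\
  arrow_class v0 v1 * arrow_class v1 v2 = arrow_class v0 v1' * arrow_class v1' v2.
Proof.
move=> a01 a12 a01' a12'.
pose e1 := mk_edge a01; pose e2 := mk_edge a12.
pose f1 := mk_edge a01'; pose f2 := mk_edge a12'.
have rel i : proj ((path_poly F [:: e1; e2] - path_poly F [:: f1; f2])`_i) = 0.
  rewrite -(raddf0 proj); apply/projE; rewrite subr0.
  rewrite -[X in in_ideal X]addr0 -[X in in_ideal (X + 0)]mulr1.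
  rewrite -[X in in_ideal (X * 1 + 0)]mul1r.
  apply: in_idealD; last exact: in_ideal0.
  exists e1, [:: e2], f1, [:: f2]; split; last by exists i.
  by split; rewrite // /is_dipath /= eqxx.
have := (rel 0%N, rel 1%N); rewrite !path_poly2 !coef_quad.
have -> : arrow_class v0 v1 = proj (gen F e1) by exact: (arrow_classE e1).
have -> : arrow_class v1 v2 = proj (gen F e2) by exact: (arrow_classE e2).
have -> : arrow_class v0 v1' = proj (gen F f1) by exact: (arrow_classE f1).
have -> : arrow_class v1' v2 = proj (gen F f2) by exact: (arrow_classE f2).
move: (gen F e1) (gen F e2) (gen F f1) (gen F f2) => x1 x2 y1 y2 [r0 r1].
rewrite -!rmorphM -!raddfD; split; first exact/esym/proj_eq.
exact: proj_eq.
Qed.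

Definition lclass : letter m -> A := letter_label arrow_class.

Lemma label_lclass v w : arrow v w -> label lclass v w = arrow_class v w.
Proof.
apply: label_letter_label => v0 v1 v1' v2 h1 h2 h3 h4.
by case: (arrow_class_quad h1 h2 h3 h4).
Qed.

Lemma lclass_relations p x : forbidden p x ->
  lclass p * lclass x = \sum_y sigma F p x y *: (lclass x * lclass y).
Proof.
apply: label_relations => v0 v1 v1' v2 h1 h2 h3 h4.
have [_ E] := arrow_class_quad h1 h2 h3 h4.
exact: etrans (congr2 *%R (label_lclass h1) (label_lclass h2))
  (etrans E (esym (congr2 *%R (label_lclass h3) (label_lclass h4)))).
Qed.

Local Notation act := (@act m F).

(** Independent of the representative because the ideal acts by zero. *)
Definition nf (x : A) : W := act << [::] >> (rep x).

Lemma nf_proj x : nf (proj x) = act << [::] >> x.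
Proof.
apply/eqP; rewrite -subr_eq0 -actB; apply/eqP.
by apply: kills_ideal; apply/projE; rewrite repK.
Qed.

Lemma nf_is_linear : linear nf.
Proof.
move=> k u v; rewrite -[u](repK u) -[v](repK v).
move: (rep u) (rep v) => x y.
by rewrite -linearZ -linearD !nf_proj linearP.
Qed.

HB.instance Definition _ := GRing.isLinear.Build F A W _ nf nf_is_linear.

Lemma nfM u x : nf (u * proj x) = act (nf u) x.
Proof.
rewrite -[u](repK u); move: (rep u) => y.
by rewrite -rmorphM !nf_proj actM.
Qed.

Lemma nf1 : nf 1 = << [::] >>.
Proof. by rewrite -(rmorph1 proj) nf_proj act1. Qed.

Lemma nf_arrow u v w : arrow v w ->
  nf (u * arrow_class v w) = label (fun p => rmul p (nf u)) v w.
Proof. by move=> vw; rewrite (arrow_classE (mk_edge vw)) nfM act_gen. Qed.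

Lemma nf_letter u p : nf (u * lclass p) = rmul p (nf u).
Proof.
rewrite [u * _](letter_label_morph (u \*o idfun)) letter_label_morph.
rewrite -[RHS](letter_label_label (fun p => rmul p (nf u))).
by apply: eq_letter_label => v w; exact: nf_arrow.
Qed.

Local Notation eval := (eval lclass).

Lemma eval_edge_op z (e : edge G) : eval (edge_op e z) = eval z * proj (gen F e).
Proof.
rewrite /edge_op label_morph -arrow_classE -(label_lclass (valP e)).
rewrite [RHS](label_morph (eval z \*o idfun)); apply: eq_label => p /=.
exact/eval_rmul/lclass_relations.
Qed.

Lemma free_nil : << FMonom [::] >> = 1 :> free.
Proof. by congr mkmalgU; apply: val_inj; rewrite /= fm1. Qed.

Lemma free_cons e (s : seq (edge G)) :
  << FMonom (e :: s) >> = gen F e * << FMonom s >> :> free.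
Proof. by rewrite /gen malgUM; congr mkmalgU; apply: val_inj; rewrite /= fmM. Qed.

Lemma eval_act z x : eval (act z x) = eval z * proj x.
Proof.
move: x; apply: eq_on_basis => [k u v|k u v|[s]].
- by rewrite !linearP.
- by rewrite linearP mulrDr scalerAr.
rewrite actU /word_op /=; elim: s z => [|e s IH] z.
  by rewrite free_nil rmorph1 mulr1.
by rewrite [LHS]IH free_cons rmorphM mulrA eval_edge_op.
Qed.

(** The action of an element on the empty word evaluates back to that element,
    so [nf] is injective and the relations between the letters present A. *)
Lemma nfK : cancel nf eval.
Proof. by move=> u; rewrite /nf eval_act eval_nil mul1r repK. Qed.

Definition homogeneous n (x : free) :=
  forall k : {fmonom (edge G)}, mcoeff k x != 0 -> size k = n.

Lemma homogeneousM n x e : homogeneous n x -> homogeneous n.+1 (x * gen F e).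
Proof.
move=> hx; rewrite [x]malg_sumE mulr_suml big_seq; apply: supported_sum => k.
rewrite -mcoeff_neq0 => xk; rewrite -scalerAl; apply: supportedZ.
by rewrite /gen malgUM; apply: supportedU; rewrite fmM size_cat addn1 (hx k xk).
Qed.

Lemma homogeneous_letter n u p : (exists2 x, homogeneous n x & u = proj x) ->
  exists2 x, homogeneous n.+1 x & u * lclass p = proj x.
Proof.
move=> [x hx ->].
have arr v w : arrow v w ->
    exists2 y, homogeneous n.+1 y & proj x * arrow_class v w = proj y.
  move=> vw; exists (x * gen F (mk_edge vw)); first exact: homogeneousM.
  by rewrite (arrow_classE (mk_edge vw)) rmorphM.
have arrB v w v' w' : arrow v w -> arrow v' w' ->
    exists2 y, homogeneous n.+1 y &
      proj x * (arrow_class v w - arrow_class v' w') = proj y.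
  move=> /arr[y hy E] /arr[y' hy' E']; exists (y - y').
    by apply: supportedD => //; exact: supportedN.
  by rewrite mulrBr E E' raddfB.
by case: p => [||||||| i]; first [exact: arr | exact: arrB].
Qed.

Lemma edge_op_size n (e : edge G) (z : W) : supported (fun w => size w = n) z ->
  supported (fun w => size w = n.+1) (edge_op e z).
Proof.
move=> hz.
have hr p : supported (fun w => size w = n.+1) (rmul p z).
  rewrite /rmul locked_withE; apply: supported_linext hz => w <-; exact: rword_size.
apply: label_closed => //; first exact: supported0.
  by move=> u v; exact: supportedD.
by move=> u; exact: supportedN.
Qed.

Lemma homogeneous_eval n u : (exists2 x, homogeneous n x & u = proj x) <->
  exists2 z : W, supported (fun w : seq (letter m) => size w = n) z & u = eval z.
Proof.
split=> [[x hx ->]|[z hz ->]].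
  exists (nf (proj x)); last by rewrite nfK.
  rewrite nf_proj actE big_seq; apply: supported_sum => -[s].
  rewrite -mcoeff_neq0 => /hx /= <-; apply: supportedZ; rewrite /word_op /=.
  have fs (k : nat) (z : W) : supported (fun w => size w = k) z ->
      supported (fun w => size w = size s + k)%N (foldl (fun z e => edge_op e z) z s).
    elim: s k z {x hx} => [|e s IH] k z hz //=.
    by rewrite addSnnS; apply: IH; exact: edge_op_size.
  by rewrite -[size s]addn0; apply: fs; exact: supportedU.
have hD x y : (exists2 x', homogeneous n x' & x = proj x') ->
    (exists2 y', homogeneous n y' & y = proj y') ->
    exists2 z', homogeneous n z' & x + y = proj z'.
  move=> [x' hx ->] [y' hy ->]; exists (x' + y'); last by rewrite raddfD.
  exact: supportedD.
rewrite eval_sumE big_seq; elim/big_ind: _ => //.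
  by exists 0; [exact: supported0 | rewrite raddf0].
move=> w; rewrite -mcoeff_neq0 => zw; have := hz w zw; move: n {hz zw hD} => n <-.
have [x hx ->] : exists2 x, homogeneous (size w) x & eval << w >> = proj x.
  elim: w => [|p w IH]; last by rewrite eval_cons; exact: homogeneous_letter.
  exists 1; last by rewrite eval_nil rmorph1.
  by rewrite -free_nil; exact: supportedU.
exists (z@_w *: x); last by rewrite linearZ.
exact: supportedZ.
Qed.

End Presentation.

(** * Uniformity, and the resulting Koszul algebra *)
Section GraphProperties.
Variable m : nat.
Local Notation G := (graph m).

Lemma arrow_below (v w : vertex G) : arrow v w -> below w v.
Proof. by move=> vw; apply/existsP; exists (mk_edge vw); rewrite eqxx connect0. Qed.

(** Any two distinct heads of edges with a common tail have a common lower
    neighbour: W1 if the tail is Top, and Star otherwise. *)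
Lemma graph_uniform : uniform G.
Proof.
move=> e e' tt.
have be : below (ehead e) (etail e) by exact: arrow_below (valP e).
have be' : below (ehead e') (etail e) by rewrite tt; exact: arrow_below (valP e').
have [hh|nhh] := eqVneq (ehead e) (ehead e').
  by exists [::]; split=> //; exact/andP.
exists [:: ehead e']; split=> //; last by apply/and3P.
apply/andP; split=> //.
have [w [h h']] : exists w : vtx m, arrow (ahead e) w /\ arrow (ahead e') w.
  have a : arrow (atail e) (ahead e) := valP e.
  have a' : arrow (atail e') (ahead e') := valP e'.
  have {}tt : atail e = atail e' := tt.
  have {}nhh : ahead e != ahead e' := nhh.
  rewrite -{}tt in a'; move: (atail e) (ahead e) (ahead e') a a' nhh {be be'}.
  by case=> [||||||||i] [||||||||j] // [||||||||k] // _ _ n;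
    first [by exists (W1 m) | by exists (Star m) | by rewrite eqxx in n].
have l : vlevel (ahead e) = (vlevel w).+1 :> nat by exact: arrow_level.
have l' : vlevel (ahead e') = (vlevel w).+1 :> nat by exact: arrow_level.
apply/andP; split; first by apply/eqP/val_inj; rewrite /= l l'.
apply/existsP; exists w; rewrite (arrow_below h) (arrow_below h') !andbT.
exact/eqP/esym.
Qed.

Lemma graph_layer0 : layer G 0 = [set Star m].
Proof. by apply/setP => v; rewrite !inE; case: v. Qed.

Lemma graph_layer3 : layer G 3 = [set Top m].
Proof. by apply/setP => v; rewrite !inE; case: v. Qed.

Lemma graph_minimal (v : vertex G) : minimal v <-> v = Star m.
Proof.
split=> [/forallP min|->].
  have no w : arrow v w -> False by move/arrow_below; exact/negP/min.
  case: v no {min} => [||||||||i] // no.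
  - by case: (no (VQ m)).
  - by case: (no (W1 m)).
  - by case: (no (W1 m)).
  - by case: (no (W1 m)).
  - by case: (no (Star m)).
  - by case: (no (Star m)).
  - by case: (no (Star m)).
  - by case: (no (W1 m)).
apply/forallP => w; apply/existsP => -[e /andP[/eqP te _]].
have : arrow (atail e) (ahead e) := valP e.
by rewrite [atail e]te.
Qed.

Lemma graph_algP (F : fieldType) n u : @graph_alg_deg F 3 G n u <->
  exists2 z : {malg F[seq (letter m)]},
    supported (fun w : seq (letter m) => size w = n) z &
    u = eval (lclass (@graph_alg_pi F 3 G)) z.
Proof. exact: (homogeneous_eval (@graph_alg_piE F 3 G) (@graph_alg_reprK F 3 G)). Qed.

Lemma graph_koszul (F : fieldType) : koszul (@graph_alg_deg F 3 G).
Proof.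
pose pE := @graph_alg_piE F 3 G; pose rK := @graph_alg_reprK F 3 G.
exact: (model_koszul (lclass_relations pE) (nf1 pE rK) (nf_letter pE rK) (nfK pE rK)
  (@graph_algP F)).
Qed.

Lemma graph_hilbert (F : fieldType) : hilbert_series_inv_of (@graph_alg_deg F 3 G)
  (1 - (m + 9)%:R *: 'X + (m + 9)%:R *: 'X^2 - 'X^3).
Proof.
pose pE := @graph_alg_piE F 3 G; pose rK := @graph_alg_reprK F 3 G.
exact: (model_hilbert (nf1 pE rK) (nf_letter pE rK) (nfK pE rK) (@graph_algP F)).
Qed.

End GraphProperties.

Theorem mainTheorem6 (F : fieldType) (r : nat) (hr : (9 <= r)%N) :
  exists G : layered_graph 3,
    uniform G /\
    (exists star : vertex G,
       layer G 0 = [set star] /\ (forall v : vertex G, minimal v <-> v = star)) /\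
    #|layer G 3| = 1%N /\
    koszul (@graph_alg_deg F 3 G) /\
    hilbert_series_inv_of (@graph_alg_deg F 3 G)
      (1 - r%:R *: 'X + r%:R *: 'X^2 - 'X^3).
Proof.
exists (graph (r - 9)); split; first exact: graph_uniform.
split; first by exists (Star _); split; [exact: graph_layer0 | exact: graph_minimal].
split; first by rewrite graph_layer3 cards1.
split; first exact: graph_koszul.
by have := graph_hilbert (r - 9) F; rewrite subnK.
Qed.
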